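(* Let $q:I\to\mathbb{R}^N$ be any $L^2$ function such that $|q(t)|=1$ for almost all $t\in I$. Then $[q]=q\tilde\Gamma$.
   Context: $I=[0,1]$. $\tilde\Gamma$ is the set of absolutely continuous $\gamma:I\to I$ with $\gamma(0)=0$, $\gamma(1)=1$, $\gamma'\ge0$ a.e.; $\Gamma\subset\tilde\Gamma$ is the subset (a group under composition) of those with $\gamma'>0$ a.e. They act on the right on $L^2(I,\mathbb{R}^N)$ by $(q*\gamma)(t)=q(\gamma(t))\sqrt{\gamma'(t)}$ (equal to $0$ where $\gamma'(t)=0$). $q\Gamma=\{q*\gamma:\gamma\in\Gamma\}$, $q\tilde\Gamma=\{q*\gamma:\gamma\in\tilde\Gamma\}$, and $[q]$ denotes the closure of $q\Gamma$ in $L^2(I,\mathbb{R}^N)$. *)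

(* Defs.v *)
From HB Require Import structures.
From mathcomp Require Import all_boot all_order all_algebra.
From mathcomp Require Import all_classical all_reals all_analysis measurable_realfun.
From mathcomp Require Import ring.
Set Implicit Arguments.
Unset Strict Implicit.
Unset Printing Implicit Defensive.
Import Order.TTheory GRing.Theory Num.Theory.
Import numFieldNormedType.Exports.
Local Open Scope classical_set_scope.
Local Open Scope ring_scope.

Definition unitI (R : realType) : set R := `[0, 1]%classic.
Arguments unitI : clear implicits.

Section euclidean_norm.
Context {R : realType} {N : nat}.
Implicit Types u v : 'rV[R]_N.

(* The library's norm on 'rV[R]_N is the sup norm. *)
Definition enorm u : R := Num.sqrt (\sum_(i < N) (u 0 i) ^+ 2).

Lemma enorm_ge0 u : 0 <= enorm u.
Proof. exact: sqrtr_ge0. Qed.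

Lemma sqr_enorm u : enorm u ^+ 2 = \sum_(i < N) (u 0 i) ^+ 2.
Proof. by rewrite sqr_sqrtr// sumr_ge0// => i _; rewrite sqr_ge0. Qed.

Lemma enorm0 : enorm 0 = 0.
Proof. by rewrite /enorm big1 ?sqrtr0// => i _; rewrite mxE expr0n. Qed.

Lemma enormN u : enorm (- u) = enorm u.
Proof.
by rewrite /enorm; congr Num.sqrt; apply: eq_bigr => i _; rewrite mxE sqrrN.
Qed.

Lemma enorm_eq0 u : enorm u = 0 -> u = 0.
Proof.
move=> u0; have := sqr_enorm u; rewrite u0 expr0n/= => /esym/eqP.
rewrite psumr_eq0; last by move=> i _; rewrite sqr_ge0.
move=> /allP h; apply/rowP => i; rewrite mxE; apply/eqP.
by have := h i; rewrite mem_index_enum sqrf_eq0 => /(_ isT).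
Qed.

Lemma dot_le_enorm u v : \sum_(i < N) u 0 i * v 0 i <= enorm u * enorm v.
Proof.
have [/enorm_eq0 ->|u0] := eqVneq (enorm u) 0.
  by rewrite enorm0 mul0r big1// => i _; rewrite mxE mul0r.
have [/enorm_eq0 ->|v0] := eqVneq (enorm v) 0.
  by rewrite enorm0 mulr0 big1// => i _; rewrite mxE mulr0.
set s := enorm u; set t := enorm v.
have s0 : 0 < s by rewrite lt_def u0 enorm_ge0.
have t0 : 0 < t by rewrite lt_def v0 enorm_ge0.
have : 0 <= \sum_(i < N) (t * u 0 i - s * v 0 i) ^+ 2.
  by rewrite sumr_ge0// => i _; rewrite sqr_ge0.
have -> : \sum_(i < N) (t * u 0 i - s * v 0 i) ^+ 2 =
    t ^+ 2 * (\sum_(i < N) (u 0 i) ^+ 2) + s ^+ 2 * (\sum_(i < N) (v 0 i) ^+ 2)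
    - (2 * (s * t)) * \sum_(i < N) u 0 i * v 0 i.
  rewrite !mulr_sumr -big_split -sumrB; apply: eq_bigr => i _ /=.
  by rewrite sqrrB !exprMn -mulr_natl; ring.
rewrite -!sqr_enorm -/s -/t.
have -> : t ^+ 2 * s ^+ 2 + s ^+ 2 * t ^+ 2 = 2 * (s * t) * (s * t) by ring.
by rewrite subr_ge0 ler_pM2l// !mulr_gt0.
Qed.

Lemma ler_enormD u v : enorm (u + v) <= enorm u + enorm v.
Proof.
rewrite -(@ler_pXn2r _ 2)// ?nnegrE ?addr_ge0 ?enorm_ge0//.
rewrite sqr_enorm sqrrD !sqr_enorm.
have -> : \sum_(i < N) ((u + v) 0 i) ^+ 2 = \sum_(i < N) (u 0 i) ^+ 2 +
    (\sum_(i < N) u 0 i * v 0 i) *+ 2 + \sum_(i < N) (v 0 i) ^+ 2.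
  rewrite -sumrMnl -!big_split; apply: eq_bigr => i _ /=.
  by rewrite mxE sqrrD.
by rewrite lerD2r lerD2l lerMn2r dot_le_enorm.
Qed.

End euclidean_norm.

Section L2norm.
Context {R : realType} {N : nat}.
Implicit Types f g : R -> 'rV[R]_N.

Definition L2measurable f :=
  forall i, measurable_fun (unitI R) (fun t => f t 0 i).

Definition L2norm f : \bar R :=
  'N[lebesgue_measure]_2%:E[EFin \o ((fun t => enorm (f t)) \_ (unitI R))].

Lemma L2norm_ge0 f : (0 <= L2norm f)%E.
Proof. exact: Lnorm_ge0. Qed.

Lemma L2norm0 : L2norm 0 = 0%E.
Proof.
rewrite /L2norm (_ : _ \o _ = cst 0%E) ?Lnorm0//.
by apply/funext => t; rewrite /= patchE enorm0 if_same.
Qed.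

Lemma L2normN f : L2norm (fun t => - f t) = L2norm f.
Proof.
rewrite /L2norm (_ : (fun t => enorm (- f t)) = fun t => enorm (f t))//.
by apply/funext => t; exact: enormN.
Qed.

Lemma L2measurableB f g : L2measurable f -> L2measurable g ->
  L2measurable (fun t => f t - g t).
Proof.
move=> mf mg i.
rewrite [X in measurable_fun _ X](_ : _ = (fun t => f t 0 i - g t 0 i)).
  by apply: measurable_funB.
by apply/funext => t; rewrite !mxE.
Qed.

Lemma measurable_L2enorm f : L2measurable f ->
  measurable_fun setT ((fun t => enorm (f t)) \_ (unitI R)).
Proof.
move=> mf; apply/(measurable_restrictT _ _).1; first exact: measurable_itv.
apply: (@measurableT_comp _ _ _ _ _ _ (Num.sqrt : R -> R)).
  by apply: continuous_measurable_fun => x; exact: sqrt_continuous.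
by apply: measurable_sum => i; apply: measurable_funX; exact: mf.
Qed.

Lemma L2normD f g : L2measurable f -> L2measurable g ->
  (L2norm (fun t => f t + g t)%R <= L2norm f + L2norm g)%E.
Proof.
move=> mf mg.
apply: le_trans (@minkowski_EFin _ _ _ lebesgue_measure _ _ 2%R
  (measurable_L2enorm mf) (measurable_L2enorm mg) (ler1n _ 2)).
rewrite /L2norm unlock /=.
have mfg : L2measurable (fun t => f t + g t).
  move=> i; rewrite [X in measurable_fun _ X](_ : _ = (fun t => f t 0 i + g t 0 i)).
    exact: measurable_funD.
  by apply/funext => t; rewrite !mxE.
have mP (h : R -> R) : measurable_fun setT h ->
    measurable_fun setT (fun t => (`|(h t)%:E| `^ 2)%E).
  move=> mh; apply: (@measurableT_comp _ _ _ _ _ _ EFin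
    _ (fun t => `|h t| `^ 2)) => //.
  apply: (measurableT_comp (measurable_powR _)).
  exact: measurableT_comp.
apply: gt0_ler_poweR => //.
- by rewrite in_itv/= leey integral_ge0// => t _; rewrite poweR_ge0.
- by rewrite in_itv/= leey integral_ge0// => t _; rewrite poweR_ge0.
apply: ge0_le_integral => //.
- exact: mP (measurable_L2enorm mfg).
- apply: mP; apply: measurable_funD; exact: measurable_L2enorm.
move=> t _ /=; rewrite lee_fin ge0_ler_powR ?nnegrE//.
rewrite !patchE; case: ifPn => _; last by rewrite addr0.
by rewrite !ger0_norm ?addr_ge0 ?enorm_ge0// ler_enormD.
Qed.

End L2norm.

(* Square-integrable functions on the unit interval. Elements are functions
   rather than classes: the pseudometric below does not separate functions that
   agree a.e., and values outside the unit interval are irrelevant. *)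
Record L2 (R : realType) (N : nat) := MkL2 {
  L2fun :> R -> 'rV[R]_N ;
  L2fun_measurable : L2measurable L2fun ;
  L2fun_finite : (L2norm L2fun < +oo)%E
}.

Section L2_pseudometric.
Context {R : realType} {N : nat}.
Implicit Types x y z : L2 R N.

Definition L2dist x y : R := fine (L2norm (fun t => x t - y t)).

Lemma L2dist_EFin x y : (L2dist x y)%:E = L2norm (fun t => x t - y t).
Proof.
rewrite /L2dist fineK// ge0_fin_numE ?L2norm_ge0//.
have mNy : L2measurable (fun t => - y t).
  move=> i; under eq_fun do rewrite mxE.
  by apply: measurableT_comp => //; exact: L2fun_measurable.
apply: le_lt_trans (L2normD (L2fun_measurable x) mNy) _.
by rewrite L2normN lte_add_pinfty// L2fun_finite.
Qed.

Lemma L2distxx x : L2dist x x = 0.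
Proof.
apply/EFin_inj; rewrite L2dist_EFin -[RHS](@L2norm0 R N); congr L2norm.
by apply/funext => t; rewrite subrr.
Qed.

Lemma L2distC x y : L2dist x y = L2dist y x.
Proof.
rewrite /L2dist -[in LHS]L2normN; congr (fine (L2norm _)).
by apply/funext => t; rewrite opprB.
Qed.

Lemma L2dist_triangle x y z : L2dist x z <= L2dist x y + L2dist y z.
Proof.
rewrite -lee_fin EFinD !L2dist_EFin.
rewrite (_ : (fun t => x t - z t) = fun t => (x t - y t) + (y t - z t)).
  by apply: L2normD; apply: L2measurableB; exact: L2fun_measurable.
by apply/funext => t; rewrite addrA subrK.
Qed.

Definition L2ball x (e : R) : set (L2 R N) := [set y | L2dist x y < e].

HB.instance Definition _ := gen_eqMixin (L2 R N).
HB.instance Definition _ := gen_choiceMixin (L2 R N).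
HB.instance Definition _ := hasNbhs.Build (L2 R N)
  (nbhs_ (entourage_ L2ball)).

Lemma L2ball_center x (e : R) : 0 < e -> L2ball x e x.
Proof. by rewrite /L2ball/= L2distxx. Qed.

Lemma L2ball_sym x y (e : R) : L2ball x e y -> L2ball y e x.
Proof. by rewrite /L2ball/= L2distC. Qed.

Lemma L2ball_triangle x y z (e1 e2 : R) :
  L2ball x e1 y -> L2ball y e2 z -> L2ball x (e1 + e2) z.
Proof.
rewrite /L2ball/= => xy yz.
by rewrite (le_lt_trans (L2dist_triangle x y z))// ltrD.
Qed.

HB.instance Definition _ := @Nbhs_isPseudoMetric.Build R (L2 R N)
  (entourage_ L2ball) erefl L2ball
  L2ball_center L2ball_sym L2ball_triangle erefl.

(* q need only be Lebesgue measurable, i.e. agree a.e. with a Borel function; L2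
   itself has Borel representatives, one at least in each class. *)
Definition is_L2 (q : R -> 'rV[R]_N) :=
  exists x : L2 R N, q = x %[ae lebesgue_measure in unitI R].

End L2_pseudometric.

Definition absolutely_continuous (R : realType) (a b : R) (f : R -> R) :=
  forall e : R, 0 < e -> exists2 d : R, 0 < d &
    forall (n : nat) (u v : 'I_n -> R),
      (forall i, [/\ a <= u i, u i <= v i & v i <= b]) ->
      trivIset setT (fun i => `]u i, v i[%classic) ->
      \sum_(i < n) (v i - u i) < d ->
      \sum_(i < n) `|f (v i) - f (u i)| < e.

Section reparametrizations.
Context {R : realType}.

(* Functions on the whole line of which only the restriction to the unit interval matters;
   the two-sided derivative at the two endpoints depends on other values, but the
   endpoints form a null set. derive1 is arbitrary where g is not derivable, hence the
   derivability clause. *)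
Definition Gamma_tilde : set (R -> R) := [set g |
  [/\ forall t, unitI R t -> unitI R (g t),
      absolutely_continuous 0 1 g,
      g 0 = 0, g 1 = 1 &
      {ae lebesgue_measure, forall t, unitI R t ->
        derivable g t 1 /\ 0 <= derive1 g t}]].

Definition Gamma : set (R -> R) := [set g |
  Gamma_tilde g /\
  {ae lebesgue_measure, forall t, unitI R t ->
    derivable g t 1 /\ 0 < derive1 g t}].

Context {N : nat}.
Implicit Type q : R -> 'rV[R]_N.

Definition reparam q (g : R -> R) : R -> 'rV[R]_N :=
  fun t => Num.sqrt (derive1 g t) *: q (g t).

(* The subset {q * g : g in G} of L2, elements being taken up to a.e. equality. *)
Definition reparam_orbit q (G : set (R -> R)) : set (L2 R N) := [set x |
  exists2 g, G g & x = reparam q g %[ae lebesgue_measure in unitI R]].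

End reparametrizations.

(* Main.v *)
(* An element of Gamma_tilde is the primitive of a probability density
   on I, so both sides of the equality are governed by densities: write T a for
   the function sqrt a * (q o A), where A is the primitive of a. Since |q| = 1,
   |T a|^2 = a almost everywhere. The change of variables by A shows that T a
   only depends on the class of q, and, after approximating q by continuous
   functions, that T is uniformly continuous from densities with the L1 metric
   to L2.

   If T a_n converges to x in L2, then a_n = |T a_n|^2 converges in L1 to
   m = |x|^2, so m is a density and x = T m. Conversely T a is the limit of
   T ((1 - s) a + s) as s tends to 0, and these densities are positive. *)
From HB Require Import structures.
Require Import Defs.
From mathcomp Require Import all_boot all_order all_algebra.
From mathcomp Require Import all_classical all_reals all_analysis measurable_realfun.
From mathcomp Require Import ring lra.
Import Order.TTheory GRing.Theory Num.Theory.
Import numFieldNormedType.Exports.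
Set Implicit Arguments.
Unset Strict Implicit.
Unset Printing Implicit Defensive.
Local Open Scope classical_set_scope.
Local Open Scope ring_scope.

(** * Absolutely continuous functions with nonnegative derivative *)

(** Absolute continuity is given by its epsilon-delta definition, so writing g as the primitive of
    g' needs its own argument: an absolutely continuous function with nonnegative derivative almost
    everywhere is nondecreasing. Applied to g, then to g minus primitives, then to an opposite
    difference, this yields measurability, integrability and the representation in turn.

    A density may vanish on a set of positive measure, so its primitive A need not be injective and
    may pull null sets back to sets of positive measure. Two facts make up for it: the image of the
    measure a dt under A is Lebesgue measure on I, and a vanishes almost everywhere on the preimage
    of a null set, so the factor sqrt a hides the values of q o A that the class of q leaves open.
    The same image measure gives the stability of T: replacing q by a continuous p costs the
    integral of |q - p|^2 over I, whatever the density. *)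

Section monotonicity.
Context {R : realType}.
Implicit Types (F G : R -> R) (s t : R).
Local Notation mu := (@lebesgue_measure R).

(** The supremum c of the points satisfying [P] need not satisfy [P] itself, which is why a step
    jumps across c, from some x close on its left to a y beyond it. Such a y contradicts the
    supremum unless c = t. *)
Lemma real_induction (P : R -> Prop) s t : s <= t -> P s ->
  (forall c, s <= c -> c <= t -> exists2 d : R, 0 < d &
     forall x y, s <= x -> x <= c -> c <= y -> y <= t ->
       c - d < x -> y < c + d -> P x -> P y) ->
  P t.
Proof.
move=> st Ps step.
pose S : set R := [set x | s <= x /\ x <= t /\ P x].
have Ss : S s by split => //; split.
have supS : has_sup S.
  by split; [exists s | exists t => x [_ []]].
set c := sup S.
have sc : s <= c by apply: ub_le_sup => //; case: supS.
have ct : c <= t by apply: ge_sup; [exists s|move=> x [_ []]].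
have [d d0 dP] := step c sc ct.
have [x [sx [xt Px]] cx] := sup_adherent d0 supS.
have xc : x <= c by apply: ub_le_sup => //; case: supS.
pose y := Num.min t (c + d / 2).
have cy : c <= y by rewrite le_min ct lerDl; lra.
have yt : y <= t by rewrite ge_min lexx.
have yd : y < c + d.
  by apply: (@le_lt_trans _ _ (c + d / 2)); [rewrite ge_min lexx orbT | lra].
have Py : P y by apply: (dP x y).
have yc : y <= c.
  by apply: ub_le_sup; [case: supS | split => //; exact: le_trans cy].
move: Py; rewrite /y; case: (leP t (c + d / 2)) => // h.
by move: yc; rewrite /y; case: (leP t (c + d / 2)) h => //; lra.
Qed.

(** A list, unlike the indexed family in [absolutely_continuous], grows on the right one interval at
    a time, as real induction requires. *)
Definition ordered_itvs a b (L : seq (R * R)) :=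
  all (fun p => [&& a <= p.1, p.1 <= p.2 & p.2 <= b]) L &&
  pairwise (fun p q : R * R => p.2 <= q.1) L.

Lemma ordered_itvs_rcons a b b' L x y : ordered_itvs a b L ->
  a <= x -> b <= x -> x <= y -> y <= b' -> ordered_itvs a b' (rcons L (x, y)).
Proof.
move=> /andP[/allP h pL] ax bx xy yb.
apply/andP; split.
  rewrite all_rcons /= ax xy yb /=; apply/allP => p /h /and3P[-> -> pb] /=.
  by rewrite (le_trans pb)// (le_trans bx)// (le_trans xy).
rewrite pairwise_rcons pL andbT; apply/allP => p /h /and3P[_ _ pb] /=.
exact: le_trans bx.
Qed.

Lemma ac_seq a b F : absolutely_continuous a b F ->
  forall e : R, 0 < e -> exists2 d : R, 0 < d & forall L, ordered_itvs a b L ->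
    \sum_(p <- L) (p.2 - p.1) < d -> \sum_(p <- L) `|F p.2 - F p.1| < e.
Proof.
move=> acF e e0; have [d d0 dP] := acF e e0; exists d => // L.
move=> /andP[/allP hL pL].
pose u (i : 'I_(size L)) := (nth (0, 0) L i).1.
pose v (i : 'I_(size L)) := (nth (0, 0) L i).2.
rewrite !(big_nth (0, 0)) !big_mkord => Ld.
apply: (dP _ u v) => //.
  by move=> i; have /hL /and3P[] := mem_nth (0, 0) (ltn_ord i).
have pP := pairwiseP (0, 0) pL.
have H (i j : 'I_(size L)) z : (i < j)%N ->
    `]u i, v i[%classic z -> `]u j, v j[%classic z -> False.
  move=> ij /=; rewrite !in_itv/= => /andP[_ z1] /andP[z2 _].
  have := pP i j; rewrite !inE !ltn_ord => /(_ isT isT ij) h.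
  by have := lt_trans z2 z1; rewrite ltNge h.
apply/trivIsetP => i j _ _ ij; apply/seteqP; split => // z [zi zj].
have [ij'|ji] := ltnP i j; first exact: H ij' zi zj.
by apply: (H j i z _ zj zi); rewrite ltn_neqAle eq_sym ij.
Qed.

(** Differentiability at c controls only increments with one end at c. Adding those of [x, c] and
    [c, y] covers every increment that straddles c, which is the kind [real_induction] asks for. *)
Lemma derivable_ge0_near F (c e : R) : 0 < e -> derivable F c 1 ->
  0 <= derive1 F c ->
  exists2 d : R, 0 < d & forall x y, x <= c -> c <= y -> c - d < x ->
    y < c + d -> - e * (y - x) <= F y - F x.
Proof.
move=> e0 dF; rewrite derive1E /derive => F0.
have /cvgr_dist_lt /(_ e e0) := dF.
move=> [d /= d0 dP]; exists d => //.
have H h : `|h| < d -> h != 0 -> - e < h^-1 * (F (c + h) - F c).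
  move=> hd h0; have := dP h; rewrite /ball_/= sub0r normrN => /(_ hd h0).
  rewrite ltr_distlC => /andP[+ _]; rewrite /GRing.scale/= mulr1 [h + c]addrC.
  by apply: le_lt_trans; rewrite lerBrDr addNr.
move=> x y xc cy cdx ycd.
have h1 : - e * (y - c) <= F y - F c.
  have [<-|yc] := eqVneq c y; first by rewrite !subrr mulr0.
  have yc0 : 0 < y - c by rewrite subr_gt0 lt_neqAle yc.
  have := H (y - c); rewrite gtr0_norm// subrKC ltrBlDr [d + c]addrC ycd gt_eqF//.
  by move=> /(_ isT isT); rewrite -ltr_pdivrMl ?invr_gt0// invrK mulrC => /ltW.
have h2 : - e * (c - x) <= F c - F x.
  have [->|yc] := eqVneq c x; first by rewrite !subrr mulr0.
  have yc0 : 0 < c - x by rewrite subr_gt0 lt_neqAle eq_sym yc.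
  have := H (x - c); rewrite distrC gtr0_norm// subrKC ltrBlDr -ltrBlDl cdx.
  rewrite subr_eq0 eq_sym yc => /(_ isT isT).
  rewrite -(opprB c x) invrN mulNr -mulrN opprB -ltr_pdivrMl ?invr_gt0//.
  by rewrite invrK mulrC => /ltW.
lra.
Qed.

(* Off a null set F has local difference quotients at least -e/2; the null
   set is covered by an open set U so small that the total variation of F over
   U is below e/2. Real induction chains the two kinds of steps. *)
Theorem ac_derive1_ge0_nondecreasing F : absolutely_continuous 0 1 F ->
  {ae mu, forall t, unitI R t -> derivable F t 1 /\ 0 <= derive1 F t} ->
  forall s t, 0 <= s -> s <= t -> t <= 1 -> F s <= F t.
Proof.
move=> acF [N [mN N0 sN]] s t s0 st t1.
apply/ler_addgt0Pl => e e0.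
have e20 : 0 < e / 2 by rewrite divr_gt0.
have [d d0 dP] := ac_seq acF e20.
have [U [oU NU Ud]] : exists U, [/\ open U, N `<=` U & (mu U < d%:E)%E].
  have Nfin : (mu N < +oo)%E by rewrite N0 ltry.
  have [U [oU NU Ud]] := lebesgue_regularity_outer mN Nfin d0.
  exists U; split => //.
  have mU := open_measurable oU.
  apply: le_lt_trans Ud; rewrite (measureDI mu mU mN).
  rewrite [X in (_ + X)%E](_ : _ = 0%E) ?adde0//.
    apply/eqP; rewrite eq_le measure_ge0 andbT -N0.
    by apply: le_measure; rewrite ?inE//; exact: measurableI.
have mU := open_measurable oU.
(* The list records the steps taken inside [U], where the derivative gives no control. Their
   variation is carried along and bounded only at the end: the total length stays below the measure
   of [U], so absolute continuity applies to the whole list at once. *)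
pose P y := exists L, [/\ ordered_itvs s y L,
  ((\sum_(p <- L) (p.2 - p.1))%:E <= mu (U `&` `[s, y]))%E &
  - (e / 2) * (y - s) - \sum_(p <- L) `|F p.2 - F p.1| <= F y - F s].
have : P t.
  apply: (real_induction st).
    exists [::]; split => //; first by rewrite big_nil.
    by rewrite big_nil !subrr mulr0 subr0.
  move=> c sc ct.
  have [Uc|Uc] := pselect (U c).
    have [r /= r0 rU] := open_nbhs_nbhs (conj oU Uc).
    exists r => // x y sx xc cy yt crx ycr [L [oL LU LF]].
    have xy := le_trans xc cy.
    exists (rcons L (x, y)); rewrite !big_rcons/=; split.
    - exact: ordered_itvs_rcons oL _ _ _ _.
    - rewrite EFinD; apply: (@le_trans _ _ (mu ((U `&` `[s, x]) `|` `]x, y[))).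
        rewrite measureU//; last 2 first.
          exact: measurableI.
          apply/seteqP; split => // z /=; rewrite !in_itv/= => -[[_ /andP[_ h]]].
          by rewrite ltNge h.
        rewrite leeD//.
        rewrite [leRHS]lebesgue_measure_itv/= lte_fin; case: ifPn => // xy'.
        by rewrite lee_fin subr_le0 leNgt.
      apply: le_measure; rewrite ?inE.
      + by apply: measurableU => //; exact: measurableI.
      + exact: measurableI.
      + move=> z /= [[Uz]|]; rewrite !in_itv/=.
          by move=> /andP[-> zx]; split => //; exact: le_trans zx xy.
        move=> /andP[xz zy]; rewrite (ltW (le_lt_trans sx xz)) (ltW zy); split => //.
        apply: rU; rewrite /ball_/= ltr_distlC; apply/andP; split; lra.
    - have := ler_norm (- (F y - F x)); rewrite normrN => h.
      have : - (e / 2) * (y - x) <= 0.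
        by rewrite mulNr oppr_le0 mulr_ge0 ?subr_ge0// ltW.
      lra.
  have Ic : unitI R c by rewrite /unitI/= in_itv/=; apply/andP; split; lra.
  have [dc Fc] : derivable F c 1 /\ 0 <= derive1 F c.
    by apply: contrapT => h; apply/Uc/NU/sN => /(_ Ic).
  have [r r0 rP] := derivable_ge0_near e20 dc Fc.
  exists r => // x y sx xc cy yt crx ycr [L [oL LU LF]].
  have xy := le_trans xc cy.
  exists L; split.
  - move: oL => /andP[/allP h pL]; rewrite /ordered_itvs pL andbT.
    by apply/allP => p /h /and3P[-> -> px]; rewrite (le_trans px).
  - apply: (le_trans LU); apply: le_measure; rewrite ?inE; [exact: measurableI..|].
    by move=> z /= []; rewrite !in_itv/= => Uz /andP[-> zx]; split => //; exact: le_trans xy.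
  - have := rP x y xc cy crx ycr; lra.
move=> [L [oL LU LF]].
have : \sum_(p <- L) `|F p.2 - F p.1| < e / 2.
  apply: dP.
    move: oL => /andP[/allP h pL]; rewrite /ordered_itvs pL andbT.
    by apply/allP => p /h /and3P[sp -> px]; rewrite (le_trans s0)// (le_trans px).
  rewrite -lte_fin (le_lt_trans LU)// (le_lt_trans _ Ud)//.
  by apply: le_measure; rewrite ?inE//; exact: measurableI.
have : (e / 2) * (t - s) <= e / 2.
  by rewrite ler_piMr// ?(ltW e20)//; lra.
lra.
Qed.

End monotonicity.

(** * Primitives of integrable functions *)

Section primitive.
Context {R : realType}.
Implicit Types (F G a b : R -> R) (s t : R).
Local Notation mu := (@lebesgue_measure R).

Lemma acB F G : absolutely_continuous 0 1 F -> absolutely_continuous 0 1 G ->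
  absolutely_continuous 0 1 (fun t => F t - G t).
Proof.
move=> acF acG e e0; have e2 : 0 < e / 2 by rewrite divr_gt0.
have [d d0 dF] := acF _ e2; have [d' d'0 dG] := acG _ e2.
exists (Num.min d d') => [|n u v uv tI]; first by rewrite lt_min d0.
rewrite lt_min => /andP[/(dF _ _ _ uv tI) h1 /(dG _ _ _ uv tI) h2].
rewrite [e]splitr; apply: le_lt_trans (ltrD h1 h2).
rewrite -big_split /=; apply: ler_sum => i _.
by rewrite opprB [X in X <= _](_ : _ = `|(F (v i) - F (u i)) - (G (v i) - G (u i))|)
  ?ler_normB//; congr `| _ |; ring.
Qed.

(** Integrating from -oo gives a function on the whole line; for a density, which vanishes outside
    I, it is the integral from 0. *)
Definition primitive a t : R := (\int[mu]_(x in `]-oo, t]) a x)%R.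

Lemma primitiveB a s t : mu.-integrable setT (EFin \o a) -> s <= t ->
  primitive a t - primitive a s = (\int[mu]_(x in `]s, t]) a x)%R.
Proof.
move=> ia st; rewrite /primitive Rintegral_itvB//.
exact: integrableS ia.
Qed.

(** The increments over disjoint intervals add up to at most the integral of |a| over their union, a
    set of small measure, so the absolute continuity of the integral applies. *)
Lemma primitive_ac a : mu.-integrable setT (EFin \o a) ->
  absolutely_continuous 0 1 (primitive a).
Proof.
move=> ia e e0; have [d [d0 dP]] := integral_normr_continuous ia e0.
exists d => // n u v uv tI uvd.
have ma : measurable_fun setT a by case/integrableP: ia => /measurable_EFinP.
pose J (i : 'I_n) : set R := `]u i, v i[%classic.
pose D := \big[setU/set0]_(i < n) J i.
have mD : measurable D.
  by apply: bigsetU_measurable => i _; exact: measurable_itv.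
have tJ : trivIset [set` index_enum 'I_n] J by apply: sub_trivIset tI.
have JE (f : R -> \bar R) : measurable_fun setT f -> (forall x, 0 <= f x)%E ->
    (\int[mu]_(x in D) f x = \sum_(i < n) \int[mu]_(x in J i) f x)%E.
  move=> mf f0; rewrite ge0_integral_bigsetU//.
  - by move=> i; exact: measurable_itv.
  - exact: index_enum_uniq.
  - exact: measurable_funTS.
have muD : (mu D < d%:E)%E.
  rewrite -[mu D]mul1e -integral_cst// (JE (cst 1%E))//.
  rewrite (eq_bigr (fun i => (v i - u i)%:E)); first by rewrite sumEFin lte_fin.
  move=> i _; rewrite integral_cst ?mul1e; last exact: measurable_itv.
  rewrite [LHS]lebesgue_measure_itv/= lte_fin; have [_ + _] := uv i.
  by rewrite le_eqVlt => /orP[/eqP ->|->//]; rewrite ltxx subrr.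
have iDa : mu.-integrable D (EFin \o a) by exact: integrableS ia.
apply: le_lt_trans (dP D mD muD).
have mna : measurable_fun setT (fun x => `|(a x)%:E|%E).
  by do 2 apply: measurableT_comp => //.
rewrite -lee_fin /Rintegral fineK; last first.
  by apply: integrable_fin_num => //; exact: integrable_abse iDa.
rewrite (JE (fun x => `|(a x)%:E|%E)) // -sumEFin; apply: lee_sum => i _.
have [_ uvi _] := uv i.
rewrite primitiveB// EFin_normr_Rintegral//; last exact: integrableS ia.
have mea : measurable_fun setT (EFin \o a) by case/integrableP: ia.
have := le_abse_integral mu (measurable_itv `]u i, v i]) (measurable_funTS mea).
move/le_trans; apply.
rewrite integral_itv_bndoo//; exact: measurable_funTS.
Qed.

Lemma primitive_derive a : mu.-integrable setT (EFin \o a) ->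
  {ae mu, forall t, derivable (primitive a) t 1 /\ derive1 (primitive a) t = a t}.
Proof.
move=> ia; apply: FTC1Ny => [y|]; first exact: integrableS ia.
by apply: open_integrable_locally => //; exact: openT.
Qed.

End primitive.

(** * Densities and reparametrizations *)

Section density.
Context {R : realType}.
Implicit Types (F G a b : R -> R) (s t : R).
Local Notation mu := (@lebesgue_measure R).

Lemma filterS_ae (P Q : R -> Prop) : {ae mu, forall t, P t} ->
  (forall t, P t -> Q t) -> {ae mu, forall t, Q t}.
Proof. by move=> aP PQ; exact: (@filterS _ _ (ae_filter_ringOfSetsType mu) _ _ PQ). Qed.

Lemma filterS2_ae (P Q S : R -> Prop) : {ae mu, forall t, P t} ->
  {ae mu, forall t, Q t} ->
  (forall t, P t -> Q t -> S t) -> {ae mu, forall t, S t}.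
Proof. by move=> aP aQ PQ; exact: (@filterS2 _ _ (ae_filter_ringOfSetsType mu) _ _ _ PQ). Qed.

Lemma ae_neq (c : R) : {ae mu, forall t, t != c}.
Proof.
exists [set c]; split; first exact: measurable_set1.
  exact: lebesgue_measure_set1.
by move=> t /= /negP; rewrite negbK => /eqP.
Qed.

(** Sign and support are imposed at every point, not just almost everywhere, so that primitives are
    monotone on the line and map it into I. *)
Definition density a := [/\ measurable_fun setT a, forall t, 0 <= a t,
  forall t, ~ unitI R t -> a t = 0 & (\int[mu]_t (a t)%:E = 1)%E].

Lemma ge0_integrable a : measurable_fun setT a -> (forall t, 0 <= a t) ->
  (\int[mu]_t (a t)%:E < +oo)%E -> mu.-integrable setT (EFin \o a).
Proof.
move=> ma a0 ia; apply/integrableP; split; first exact/measurable_EFinP.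
by apply: le_lt_trans ia; rewrite le_eqVlt; apply/orP; left; apply/eqP/eq_integral => t _ /=;
  rewrite ger0_norm.
Qed.

Lemma density_integrable a : density a -> mu.-integrable setT (EFin \o a).
Proof. by move=> [ma a0 _ ia]; apply: ge0_integrable => //; rewrite ia ltry. Qed.

Lemma primitive_nd a s t : mu.-integrable setT (EFin \o a) -> (forall t, 0 <= a t) ->
  s <= t -> primitive a s <= primitive a t.
Proof.
move=> ia a0 st; rewrite -subr_ge0 primitiveB//.
by apply: Rintegral_ge0 => x _; exact: a0.
Qed.

Lemma primitive_le0 a t : (forall t, ~ unitI R t -> a t = 0) -> t <= 0 -> primitive a t = 0.
Proof.
move=> aI t0; rewrite /primitive/Rintegral.
have [->|tn0] := eqVneq t 0.
  (* The closed ray contains 0, a point of I where [a] may be nonzero; removing that point does not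
     change the integral. *)
  rewrite -integral_itv_bndo_bndc; last first.
    apply: (eq_measurable_fun (cst 0%E)) => // x; rewrite inE/= in_itv/= => x0.
    by rewrite aI// /unitI/= in_itv/= leNgt x0.
  rewrite integral0_eq// => x; rewrite /= in_itv/= => x0.
  by rewrite aI// /unitI/= in_itv/= leNgt x0.
rewrite integral0_eq// => x; rewrite /= in_itv/= => x0.
rewrite aI// /unitI/= in_itv/= leNgt (le_lt_trans x0)//.
by rewrite lt_neqAle tn0.
Qed.

Lemma primitive_ge1 a t : (forall t, ~ unitI R t -> a t = 0) -> 1 <= t ->
  primitive a t = fine (\int[mu]_t (a t)%:E)%E.
Proof.
move=> aI t1; rewrite /primitive/Rintegral integral_mkcond; congr fine.
apply: eq_integral => x _; rewrite patchE; case: ifPn => //.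
rewrite notin_setE/= in_itv/= => /negP; rewrite -ltNge => tx.
rewrite aI// /unitI/= in_itv/= [x <= 1]leNgt (le_lt_trans t1)//.
by rewrite andbF.
Qed.

Lemma density_Gamma_tilde a : density a -> Gamma_tilde (primitive a).
Proof.
move=> da; have ia := density_integrable da; move: (da) => [ma a0 aI a1].
have p0 : primitive a 0 = 0 by apply: primitive_le0.
have p1 : primitive a 1 = 1 by rewrite primitive_ge1// a1.
split => //.
- move=> t; rewrite /unitI/= !in_itv/= => /andP[t0 t1].
  by rewrite -{1}p0 -{1}p1 !primitive_nd.
- exact: primitive_ac.
- by apply: (filterS_ae (primitive_derive ia)) => t [dt ->] _.
Qed.

End density.

(** * Reparametrizations as primitives of densities *)

Section representation.
Context {R : realType}.
Implicit Types (F G a b : R -> R) (s t : R).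
Local Notation mu := (@lebesgue_measure R).

Lemma derivable1B F G t : derivable F t 1 -> derivable G t 1 ->
  derivable (fun x => F x - G x) t 1 /\
  derive1 (fun x => F x - G x) t = derive1 F t - derive1 G t.
Proof.
by move=> dF dG; split; [exact: derivableB | rewrite !derive1E -deriveB].
Qed.

Lemma difference_quotient_cvg F t : derivable F t 1 ->
  n.+1%:R * (F (t + n.+1%:R^-1) - F t) @[n --> \oo] --> derive1 F t.
Proof.
rewrite derive1E /derive => /cvgr_dist_lt dF.
apply/cvgrPdist_lt => e e0; have [d /= d0 dP] := dF e e0.
near=> n; have := dP (n.+1%:R^-1); rewrite /ball_/= sub0r normrN gtr0_norm//.
rewrite invrK /GRing.scale/= mulr1 [_ + t]addrC; apply.
  by near: n; exact: near_infty_natSinv_lt (PosNum d0).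
by rewrite gt_eqF.
Unshelve. all: by end_near. Qed.

Lemma Gamma_tilde_nd g : Gamma_tilde g ->
  forall s t, 0 <= s -> s <= t -> t <= 1 -> g s <= g t.
Proof.
by move=> [_ acg _ _ ag]; apply: ac_derive1_ge0_nondecreasing.
Qed.

(* b is the upper limit of the difference quotients of g, frozen outside I, and
   hence Borel. *)
Lemma Gamma_tilde_derive g : Gamma_tilde g -> exists b,
  [/\ measurable_fun setT b, forall t, 0 <= b t, forall t, ~ unitI R t -> b t = 0 &
   {ae mu, forall t, unitI R t -> derivable g t 1 /\ derive1 g t = b t}].
Proof.
move=> Gg; have gnd := Gamma_tilde_nd Gg; move: Gg => [gI acg g0 g1 ag].
pose c t : R := Num.min 1 (Num.max 0 t).
have cP x : [\/ x <= 0 /\ c x = 0, (0 <= x /\ x <= 1) /\ c x = x | 1 <= x /\ c x = 1].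
  rewrite /c; case: (leP 0 x) => x0; last by apply: Or31; rewrite min_r// ltW.
  by case: (leP 1 x) => x1; [apply: Or33 | apply: Or32; rewrite (ltW x1)].
have c_nd : {homo c : x y / x <= y}.
  by move=> x y xy; case: (cP x) => -[? ->]; case: (cP y) => -[? ->]; lra.
have c01 x : 0 <= c x /\ c x <= 1 by case: (cP x) => -[? ->]; lra.
have cE x : 0 <= x -> x <= 1 -> c x = x.
  by move=> x0 x1; rewrite /c max_r// min_r.
pose h t := g (c t).
have h_nd : {homo h : x y / x <= y}.
  move=> x y xy; apply: gnd; [by have [] := c01 x| exact: c_nd|by have [] := c01 y].
have mh : measurable_fun setT h by apply: nondecreasing_measurable.
pose q n t : \bar R := (n.+1%:R * (h (t + n.+1%:R^-1) - h t))%:E.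
have mq n : measurable_fun setT (q n).
  apply/measurable_EFinP; apply: measurable_funM => //.
  apply: measurable_funB => //.
  by apply: (measurableT_comp mh); exact: measurable_funD.
pose D t := fine (limn_esup (q^~ t)).
have mD : measurable_fun setT D.
  apply: (measurableT_comp (fine_measurable measurableT)).
  exact: measurable_fun_limn_esup.
exists ((fun t => Num.max 0 (D t)) \_ (unitI R)); split.
- apply/(measurable_restrictT _ _).1; first exact: measurable_itv.
  by apply: measurable_funTS; apply: measurable_maxr.
- by move=> t; rewrite patchE; case: ifP => // _; rewrite le_max lexx.
- by move=> t It; rewrite patchE memNset.
(* At t = 1 the forward quotients of [h] see only its frozen values. At every other point of I they
   agree with those of [g] for large n. *)
- apply: (filterS2_ae (ae_neq 1) ag) => t tn1 gt It; have [dg g'0] := gt It.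
  split => //; rewrite patchE mem_set//.
  move: It; rewrite /unitI/= in_itv/= => /andP[t0 t1].
  have tlt1 : t < 1 by rewrite lt_neqAle tn1.
  have : q n t @[n --> \oo] --> (derive1 g t)%:E.
    apply: cvg_EFin; first exact: nearW.
    have := difference_quotient_cvg dg; apply: cvg_trans; apply: near_eq_cvg.
    near=> n; rewrite /q /= /h !cE//.
      by rewrite addr_ge0.
    rewrite -lerBrDl; apply: ltW; near: n.
    by apply: near_infty_natSinv_lt (PosNum (_ : 0 < 1 - t)); rewrite subr_gt0.
  by move=> /cvg_limn_einf_sup[_ dE]; rewrite /D dE/= max_r.
Unshelve. all: by end_near. Qed.

Lemma integrable_truncation b (k : R) : measurable_fun setT b ->
  (forall t, 0 <= b t) -> (forall t, ~ unitI R t -> b t = 0) -> 0 <= k ->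
  mu.-integrable setT (fun t => (Num.min (b t) k)%:E).
Proof.
move=> mb b0 bI k0.
have mm : measurable_fun setT (b \min (fun=> k)) by apply: measurable_minr.
apply: ge0_integrable => //.
  by move=> t; rewrite le_min b0.
apply: (@le_lt_trans _ _ (\int[mu]_t ((cst k%:E) \_ (unitI R)) t)%E).
  apply: ge0_le_integral => //.
  - by move=> t _; rewrite lee_fin le_min b0.
  - exact/measurable_EFinP.
  - apply/(measurable_restrictT _ _).1; first exact: measurable_itv.
    exact: measurable_cst.
  - move=> t _; rewrite patchE; case: ifPn => [_|]; first by rewrite lee_fin ge_min lexx orbT.
    by rewrite notin_setE => /bI ->; rewrite lee_fin ge_min lexx.
rewrite -integral_mkcond integral_cst; last exact: measurable_itv.
by rewrite [X in (_ * X)%E]lebesgue_measure_itv/= lte_fin ltr01 -EFinB -EFinM ltry.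
Qed.

(* The integrability of g' comes from the monotonicity of g - primitive (bk k),
   where bk k is g' truncated at k. *)
Theorem Gamma_tilde_density g : Gamma_tilde g -> exists a,
  [/\ density a, forall t, unitI R t -> g t = primitive a t &
      {ae mu, forall t, unitI R t -> derive1 g t = a t}].
Proof.
move=> Gg; have [b [mb b0 bI bae]] := Gamma_tilde_derive Gg.
move: (Gg) => [gI acg g0 g1 ag].
pose bk (k : nat) t := Num.min (b t) k%:R.
have ibk k : mu.-integrable setT (EFin \o bk k) by exact: integrable_truncation.
have bkI k t : ~ unitI R t -> bk k t = 0.
  by move=> /bI bt; rewrite /bk bt min_l.
have bk1 k : (\int[mu]_t (bk k t)%:E <= 1)%E.
  have : g 0 - primitive (bk k) 0 <= g 1 - primitive (bk k) 1.
    apply: (@ac_derive1_ge0_nondecreasing _ (fun t => g t - primitive (bk k) t)) => //.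
      by apply: acB => //; exact: primitive_ac.
    apply: (filterS2_ae bae (primitive_derive (ibk k))) => t gt [dp pE] It.
    have [dg gE] := gt It; have [? ->] := derivable1B dg dp; split => //.
    by rewrite pE gE subr_ge0 /bk ge_min lexx.
  rewrite primitive_le0// ?g0; last exact: bkI.
  rewrite primitive_ge1//; last exact: bkI.
  rewrite g1 subrr subr_ge0 -lee_fin fineK//.
  exact: (integrable_fin_num measurableT (ibk k)).
have ib : (\int[mu]_t (b t)%:E <= 1)%E.
  have mbk k : measurable_fun setT (EFin \o bk k).
    by case/integrableP: (ibk k).
  have bk_ge0 k t : setT t -> (0 <= (bk k t)%:E)%E.
    by move=> _; rewrite lee_fin le_min b0 ler0n.
  have bk_nd t : setT t -> {homo (fun k => (bk k t)%:E) : n m / (n <= m)%N >-> (n <= m)%E}.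
    move=> _ n m nm; rewrite lee_fin le_min ge_min lexx/= ge_min ler_nat nm orbT//.
  have cv := @cvg_monotone_convergence _ _ _ mu setT measurableT _ mbk bk_ge0 bk_nd.
  rewrite (_ : (\int[mu]_t (b t)%:E)%E =
      limn (fun k => (\int[mu]_t (bk k t)%:E)%E)); last first.
    rewrite (cvg_lim _ cv)//; apply: eq_integral => t _.
    apply/esym/cvg_lim => //; apply: cvg_near_cst.
    near=> k; rewrite /= /bk min_l//; near: k; exact: nbhs_infty_ger.
  apply: lime_le; first by apply/cvg_ex; eexists; exact: cv.
  exact: nearW.
have iib : mu.-integrable setT (EFin \o b).
  by apply: ge0_integrable => //; exact: le_lt_trans ib (ltry _).
have acF : absolutely_continuous 0 1 (fun t => g t - primitive b t).
  by apply: acB => //; exact: primitive_ac.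
have acF' : absolutely_continuous 0 1 (fun t => primitive b t - g t).
  by apply: acB => //; exact: primitive_ac.
(* Both differences have zero derivative almost everywhere on I, so both are nondecreasing; being
   opposite and zero at 0, they vanish on I. *)
have gE t : unitI R t -> g t = primitive b t.
  rewrite /unitI/= in_itv/= => /andP[t0 t1].
  have h1 : g 0 - primitive b 0 <= g t - primitive b t.
    apply: (ac_derive1_ge0_nondecreasing acF) => //.
    apply: (filterS2_ae bae (primitive_derive iib)) => x gx [dp pE] Ix.
    have [dg gE] := gx Ix; have [? ->] := derivable1B dg dp; split => //.
    by rewrite pE gE subrr.
  have h2 : primitive b 0 - g 0 <= primitive b t - g t.
    apply: (ac_derive1_ge0_nondecreasing acF') => //.
    apply: (filterS2_ae bae (primitive_derive iib)) => x gx [dp pE] Ix.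
    have [dg gE] := gx Ix; have [? ->] := derivable1B dp dg; split => //.
    by rewrite pE gE subrr.
  by move: h1 h2; rewrite g0 primitive_le0//; lra.
exists b; split => //.
- split => //; have := gE 1; rewrite primitive_ge1// g1 => -> //.
  + by rewrite fineK//; exact: (integrable_fin_num measurableT iib).
  + by rewrite /unitI/= in_itv/= ler01 lexx.
- by apply: (filterS_ae bae) => t bt /bt [].
Unshelve. all: by end_near. Qed.

End representation.

(** * Change of variables *)

Section change_of_variables.
Context {R : realType}.
Implicit Types (F G b : R -> R) (s t : R).
Local Notation mu := (@lebesgue_measure R).
Context (a : R -> R) (da : density a).

Let ma : measurable_fun setT a. Proof. by case: da. Qed.
Let a0 t : 0 <= a t. Proof. by case: da. Qed.
Let aI t : ~ unitI R t -> a t = 0. Proof. by case: da => _ _ + _; apply. Qed.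
Let a1 : (\int[mu]_t (a t)%:E = 1)%E. Proof. by case: da. Qed.
Let mea : measurable_fun setT (EFin \o a). Proof. exact/measurable_EFinP. Qed.

Lemma density_primitive0 t : t <= 0 -> primitive a t = 0.
Proof. exact: primitive_le0. Qed.

Lemma density_primitive1 t : 1 <= t -> primitive a t = 1.
Proof. by move=> t1; rewrite primitive_ge1// a1. Qed.

Lemma density_primitive_nd : {homo primitive a : s t / s <= t}.
Proof. by move=> s t; apply: primitive_nd => //; exact: density_integrable. Qed.

Lemma density_primitive_itv t : 0 <= primitive a t /\ primitive a t <= 1.
Proof.
split.
  case: (leP t 0) => [/density_primitive0->//|/ltW/density_primitive_nd].
  by rewrite density_primitive0.
case: (leP 1 t) => [/density_primitive1->//|/ltW/density_primitive_nd].
by rewrite [primitive a 1]density_primitive1.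
Qed.

Lemma measurable_density_primitive : measurable_fun setT (primitive a).
Proof. by apply: nondecreasing_measurable => //; exact: density_primitive_nd. Qed.

Definition density_prob (E : set (measurableTypeR R)) : \bar R := (\int[mu]_(x in E) (a x)%:E)%E.

Let density_prob0 : density_prob set0 = 0%E.
Proof. by rewrite /density_prob integral_set0. Qed.

Let density_prob_ge0 E : (0 <= density_prob E)%E.
Proof. by apply: integral_ge0 => x _; rewrite lee_fin. Qed.

Let density_prob_sigma_additive : semi_sigma_additive density_prob.
Proof.
move=> A mA tA mUA; rewrite /density_prob/= ge0_integral_bigcup//=.
- by apply: is_cvg_ereal_nneg_natsum_cond => n _ _; exact: density_prob_ge0.
- exact: measurable_funTS.
- by move=> x _; rewrite lee_fin.
Qed.

HB.instance Definition _ := isMeasure.Build _ _ _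
  density_prob density_prob0 density_prob_ge0 density_prob_sigma_additive.

HB.instance Definition _ := @Measure_isProbability.Build _ _ R density_prob a1.

(** The change of measure is applied with the Radon-Nikodym derivative of [density_prob], which
    equals [a] almost everywhere because both have the same integral over every measurable set. *)
Lemma ge0_integral_density_prob (f : R -> \bar R) : measurable_fun setT f ->
  (forall x, 0 <= f x)%E ->
  (\int[density_prob]_x f x = \int[mu]_x (f x * (a x)%:E))%E.
Proof.
move=> mf f0.
pose P : {finite_measure set (measurableTypeR R) -> \bar R} := density_prob.
have dom : P `<< mu.
  apply/null_content_dominatesP => A mA A0; apply: null_set_integral => //.
  exact: measurable_funTS.
rewrite -(Radon_Nikodym_SigmaFinite.change_of_variables dom)//.
apply: ae_eq_integral => //.
- apply: emeasurable_funM => //.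
  exact: measurable_int (Radon_Nikodym_SigmaFinite.f_integrable dom).
- exact: emeasurable_funM.
- apply: ae_eqe_mul2l.
  apply: integral_ae_eq => //; first exact: Radon_Nikodym_SigmaFinite.f_integrable.
  by move=> E _ mE; rewrite -Radon_Nikodym_SigmaFinite.f_integral.
Qed.

Lemma primitive_continuous : continuous (primitive a).
Proof.
have ia := density_integrable da.
move=> t; apply/cvgrPdist_lt => e e0.
have [d [d0 dP]] := integral_normr_continuous ia e0.
have key x y : x <= y -> y - x < d -> `|primitive a x - primitive a y| < e.
  move=> xy yxd; rewrite distrC primitiveB//.
  have iaxy : mu.-integrable `]x, y] (EFin \o a) by exact: integrableS ia.
  have mxy : measurable (`]x, y]%classic : set (measurableTypeR R)).
    exact: measurable_itv.
  apply: le_lt_trans (le_normr_Rintegral mxy iaxy) (dP _ mxy _).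
  rewrite [ltLHS]lebesgue_measure_itv/= lte_fin; case: ifP => _; last by rewrite lte_fin.
  by rewrite lte_fin.
exists d => // s; rewrite /ball_/= => sd.
have [st|ts] := leP s t.
  by rewrite distrC key// (le_lt_trans (ler_norm _)).
by rewrite key ?(ltW ts)// (le_lt_trans (ler_norm _))// distrC.
Qed.

Lemma density_primitive_surj (y : R) : 0 <= y -> y <= 1 ->
  exists2 c, 0 <= c <= 1 & primitive a c = y.
Proof.
move=> y0 y1.
have [//|||c] := @IVT R (primitive a) 0 1 y.
- by apply: continuous_subspaceT => x; exact: primitive_continuous.
- by rewrite density_primitive0// density_primitive1// min_l// max_r// y0.
- by rewrite in_itv/= => c01 <-; exists c.
Qed.

Lemma density_prob_ray c : density_prob `]-oo, c] = (primitive a c)%:E.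
Proof.
have ia := density_integrable da.
rewrite /primitive /Rintegral fineK//; apply: integrable_fin_num => //.
exact: integrableS ia.
Qed.

Let measurable_primitive_preimage E : measurable E -> measurable (primitive a @^-1` E).
Proof.
by move=> mE; rewrite -[X in measurable X]setTI; exact: measurable_density_primitive.
Qed.

(** The law of A under the probability a dt, where A is its own distribution function; it will turn
    out to be uniform on I. *)
Definition density_image (E : set (measurableTypeR R)) : \bar R :=
  density_prob (primitive a @^-1` E).

Let density_image0 : density_image set0 = 0%E.
Proof. by rewrite /density_image preimage_set0 measure0. Qed.

Let density_image_ge0 E : (0 <= density_image E)%E.
Proof. exact: density_prob_ge0. Qed.

Let density_image_sigma_additive : semi_sigma_additive density_image.
Proof.
move=> F mF tF mUF; rewrite /density_image preimage_bigcup.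
apply: measure_semi_sigma_additive.
- by move=> n; exact: (measurable_primitive_preimage (mF n)).
- apply/trivIsetP => /= i j _ _ ij; rewrite -preimage_setI.
  by move/trivIsetP : tF => /(_ _ _ _ _ ij) ->//; rewrite preimage_set0.
- by rewrite -preimage_bigcup; exact: (measurable_primitive_preimage mUF).
Qed.

HB.instance Definition _ := isMeasure.Build _ _ _
  density_image density_image0 density_image_ge0 density_image_sigma_additive.

(** The probability integral transform. Since A may be constant on an interval, an arbitrary
    preimage of y need not bound the sublevel set exactly; for 0 < y <= 1 that set is squeezed
    between the rays ending at a preimage of y - e and at a preimage of y. *)
Lemma density_image_ray (y : R) : density_image `]-oo, y[ = mu (`]-oo, y[ `&` unitI R).
Proof.
rewrite /density_image.
have le_prob A B : measurable A -> measurable B -> A `<=` B ->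
    (density_prob A <= density_prob B)%E.
  by move=> mA mB AB; apply: le_measure; rewrite ?inE.
have mray : measurable (primitive a @^-1` `]-oo, y[) by exact: measurable_primitive_preimage.
have [y0|y0] := leP y 0.
  rewrite (_ : _ @^-1` _ = set0); last first.
    apply/seteqP; split => // t; rewrite /= in_itv/= => ty.
    by have [+ _] := density_primitive_itv t; rewrite leNgt (lt_le_trans ty).
  rewrite (_ : _ `&` _ = set0) ?measure0//.
  apply/seteqP; split => // t; rewrite /unitI/= !in_itv/= => -[ty /andP[+ _]].
  by rewrite leNgt (lt_le_trans ty).
have [y1|y1] := ltP 1 y.
  rewrite (_ : _ @^-1` _ = setT); last first.
    apply/seteqP; split => // t _; rewrite /= in_itv/=.
    by have [_ +] := density_primitive_itv t => /le_lt_trans; apply.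
  rewrite (_ : _ `&` _ = unitI R); last first.
    apply/seteqP; split => [t []//|t It]; split => //.
    by move: It; rewrite /unitI/= !in_itv/= => /andP[_ /le_lt_trans]; apply.
  by rewrite /density_prob a1 [RHS]lebesgue_measure_itv/= lte_fin ltr01 oppr0 adde0.
rewrite (_ : _ `&` _ = `[0, y[%classic); last first.
  apply/seteqP; split => t; rewrite /unitI/= !in_itv/=.
    by move=> [-> /andP[->]].
  by move=> /andP[-> ty]; rewrite ty (le_trans (ltW ty)).
rewrite [RHS]lebesgue_measure_itv/= lte_fin y0 oppr0 adde0.
apply/eqP; rewrite eq_le; apply/andP; split.
  have [c _ cy] := density_primitive_surj (ltW y0) y1.
  rewrite [leRHS](_ : _ = density_prob `]-oo, c]); last by rewrite density_prob_ray cy.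
  apply: le_prob => // t; rewrite /= !in_itv/= => ty.
  by rewrite leNgt; apply/negP => /ltW/density_primitive_nd; rewrite leNgt cy ty.
apply/lee_addgt0Pr => e e0.
have [ey|ey] := leP y e.
  by rewrite (@le_trans _ _ e%:E) ?lee_fin// leeDr// density_prob_ge0.
have [||c _ cy] := @density_primitive_surj (y - e); [lra|lra|].
rewrite -leeBlDr// -EFinB.
rewrite [leLHS](_ : _ = density_prob `]-oo, c]); last by rewrite density_prob_ray cy.
apply: le_prob => // t; rewrite /= !in_itv/= => /density_primitive_nd.
by rewrite cy => /le_lt_trans; apply; lra.
Qed.

(** Open left rays are closed under intersection, generate the Borel sets and exhaust the line, so
    two measures that agree and are finite on them coincide. *)
Lemma density_imageE E : measurable E -> density_image E = mu (E `&` unitI R).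
Proof.
move: E; have mI : measurable (unitI R : set (measurableTypeR R)) by exact: measurable_itv.
have rayI n : (RGenInftyO.G (R:=R)) `]-oo, n%:R[%classic by exists n%:R.
pose m2 : {measure set _ -> \bar R} := mrestr mu mI.
apply: (@measure_unique _ R (measurableTypeR R) (@RGenInftyO.G R)
  (fun n => `]-oo, n%:R[%classic) _ _ _ _ density_image m2).
- exact: RGenInftyO.measurableE.
- move=> _ _ [x ->] [y ->]; exists (Num.min x y).
  by apply/seteqP; split => t; rewrite /= !in_itv/= lt_min; [move=> [-> ->]|move=> /andP[]].
- exact: rayI.
- apply/seteqP; split => // t _; exists (Num.truncn `|t|).+1 => //=.
  by rewrite in_itv/= (le_lt_trans (ler_norm t))// truncnS_gt.
- by move=> _ [x ->]; exact: density_image_ray.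
- move=> n; rewrite [ltLHS]density_image_ray; apply: (@le_lt_trans _ _ (mu (unitI R))).
    by apply: le_measure; rewrite ?inE//; exact: measurableI.
  by rewrite [ltLHS]lebesgue_measure_itv/= lte_fin ltr01 oppr0 adde0 ltry.
Qed.

(** Substitution by A without injectivity: the left side is an integral against the image of a dt,
    which is Lebesgue measure on I. *)
Theorem ge0_integral_density_comp (f : R -> \bar R) : measurable_fun setT f ->
  (forall x, 0 <= f x)%E ->
  (\int[mu]_t (f (primitive a t) * (a t)%:E) = \int[mu]_(t in unitI R) f t)%E.
Proof.
move=> mf f0; have mG := measurable_density_primitive.
have mI : measurable (unitI R) by exact: measurable_itv.
have mfG : measurable_fun setT (f \o primitive a) by exact: measurableT_comp mf mG.
rewrite -(ge0_integral_density_prob mfG (fun x => f0 _)).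
have H := @ge0_integral_pushforward _ _ (measurableTypeR R) (measurableTypeR R) R
  _ mG density_prob (unitI R) f mI (measurable_funTS mf) (fun x _ => f0 x).
have preI : primitive a @^-1` unitI R = setT.
  apply/seteqP; split => // t _; rewrite /unitI/= in_itv/=; apply/andP.
  exact: density_primitive_itv.
rewrite preI in H; rewrite -[LHS]H; apply: eq_measure_integral => A mA AI.
by rewrite -[A in RHS](setIidl AI) -[RHS]density_imageE.
Qed.

(** The preimage may have positive Lebesgue measure, for instance where A is constant, but its mass
    for a dt is the measure of [N] within I, that is zero. *)
Lemma density_null_preimage N : measurable N -> mu N = 0%E ->
  {ae mu, forall t, N (primitive a t) -> a t = 0}.
Proof.
move=> mN N0.
have : (\int[mu]_(t in primitive a @^-1` N) (a t)%:E = 0)%E.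
  apply/eqP; rewrite eq_le integral_ge0 ?andbT => [|t _]; last by rewrite lee_fin.
  rewrite -[leLHS]/(density_image N) density_imageE// -N0.
  by apply: le_measure; rewrite ?inE//; apply: measurableI => //; exact: measurable_itv.
move=> i0.
have : ae_eq mu (primitive a @^-1` N) (EFin \o a) (cst 0%E).
  apply/ae_eq_integral_abs => //; first exact: measurable_primitive_preimage.
    exact: measurable_funTS.
  by rewrite -[RHS]i0; apply: eq_integral => t _ /=; rewrite ger0_norm.
by move=> h; apply: (filterS_ae h) => t /[apply] -[].
Qed.

End change_of_variables.

(** * Stability of the action under perturbation of the density *)

Section stability.
Context {R : realType}.
Implicit Types (p phi a b : R -> R) (s t : R).
Local Notation mu := (@lebesgue_measure R).

Lemma unif_continuous_unitI p (k : R) : continuous p -> 0 < k ->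
  exists2 d : R, 0 < d & forall x y, unitI R x -> unitI R y -> `|x - y| < d ->
    `|p x - p y| < k.
Proof.
move=> cp k0.
suff [d d0 dP] : exists2 d : R, 0 < d & forall x y, 0 <= x -> x <= y -> y <= 1 ->
    y - x < d -> `|p x - p y| < k.
  exists d => // x y; rewrite /unitI/= !in_itv/= => /andP[x0 x1] /andP[y0 y1] xyd.
  have [xy|yx] := leP x y.
    by apply: dP => //; apply: le_lt_trans xyd; rewrite distrC ler_norm.
  by rewrite distrC; apply: dP; rewrite ?(ltW yx)//; apply: le_lt_trans xyd; rewrite ler_norm.
pose P z := exists2 d : R, 0 < d & forall x y, 0 <= x -> x <= y -> y <= z ->
    y - x < d -> `|p x - p y| < k.
apply: (@real_induction _ P 0 1) => //.
  exists 1 => // x y x0 xy y0 _.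
  by rewrite (_ : x = y) ?subrr ?normr0//; apply/eqP; rewrite eq_le xy (le_trans y0).
move=> c c0 c1; have k2 : 0 < k / 2 by rewrite divr_gt0.
have /cvgrPdist_lt /(_ _ k2) [r /= r0 rP] := cp c.
have near_c x : c - r < x -> x < c + r -> `|p c - p x| < k / 2.
  by move=> h1 h2; apply: rP; rewrite /ball_/= ltr_distlC; apply/andP; split; lra.
exists r => // z w z0 zc cw w1 crz wcr [d d0 dP].
(* If y lies beyond z, the second bound forces x > c - r, so x and y are both within r of c. *)
exists (Num.min d (z - (c - r))); first by rewrite lt_min d0 subr_gt0.
move=> x y x0 xy yw; rewrite lt_min => /andP[xyd xyz].
have [yz|zy] := leP y z; first exact: dP.
rewrite (_ : p x - p y = (p c - p y) - (p c - p x)); last by ring.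
apply: (le_lt_trans (ler_normB _ _)); rewrite [k]splitr.
by apply: ltrD; apply: near_c; lra.
Qed.

(** One of the two factors |sqrt x - sqrt y| is at most sqrt x + sqrt y. This turns L1 closeness of
    densities into L2 closeness of their square roots. *)
Lemma sqr_sqrtB_le (x y : R) : 0 <= x -> 0 <= y ->
  (Num.sqrt x - Num.sqrt y) ^+ 2 <= `|x - y|.
Proof.
move=> x0 y0; rewrite -{2}(sqr_sqrtr x0) -{2}(sqr_sqrtr y0).
have := sqrtr_ge0 x; have := sqrtr_ge0 y.
move: (Num.sqrt x) (Num.sqrt y) => u v v0 u0.
rewrite subr_sqr normrM -real_normK ?num_real// expr2.
apply: ler_wpM2l => //; rewrite [leRHS]ger0_norm ?addr_ge0//.
by rewrite ler_norml; apply/andP; split; lra.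
Qed.

(** Clamping y to [-1, 1] does not move it away from x and leaves a distance of at most 2, which
    bounds one factor of the square. *)
Lemma sqr_sub_clamp_le (x y : R) : -1 <= x -> x <= 1 ->
  (x - Num.max (-1) (Num.min 1 y)) ^+ 2 <= 2 * `|x - y|.
Proof.
move=> x0 x1; case: (leP 1 y) => y1.
  rewrite max_r; last lra.
  have -> : `|x - y| = y - x by rewrite ler0_norm; lra.
  nra.
case: (leP (-1) y) => y0; last by have := ler_norm (x - y); nra.
rewrite -real_normK ?num_real// expr2; apply: ler_wpM2r => //.
by rewrite ler_norml; apply/andP; split; lra.
Qed.

(** Density of continuous functions in L1, turned into a mean-square estimate by clamping the
    approximant. *)
Lemma continuous_approximation phi (e : R) : measurable_fun setT phi ->
  (forall t, `|phi t| <= 1) -> 0 < e ->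
  exists p, [/\ continuous p, forall t, `|p t| <= 1 &
    (\int[mu]_(t in unitI R) ((phi t - p t) ^+ 2)%:E <= e%:E)%E].
Proof.
move=> mphi phi1 e0.
have mI : measurable (unitI R : set (measurableTypeR R)) by exact: measurable_itv.
have muI : (mu (unitI R) < +oo)%E.
  by rewrite [ltLHS]lebesgue_measure_itv/= lte_fin ltr01 oppr0 adde0 ltry.
have iphi : mu.-integrable (unitI R) (EFin \o phi).
  apply: measurable_bounded_integrable => //.
    exact: measurable_funTS.
  by exists 1; split => // M M1 t _; exact: le_trans (phi1 t) (ltW M1).
have [g [cg ig gphi]] := approximation_continuous_integrable mI muI iphi.
have e2 : 0 < e / 2 by rewrite divr_gt0.
have [n [nfin nlt]] : exists n,
    (\int[mu]_(z in unitI R) `|(phi z - g n z)%:E|)%E \is a fin_num /\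
    fine (\int[mu]_(z in unitI R) `|(phi z - g n z)%:E|)%E < e / 2.
  move/fine_cvgP: gphi => [nfin /cvgrPdist_lt /(_ _ e2) nlt].
  near \oo => n; exists n; split; first by near: n.
  have : `|0 - fine (\int[mu]_(z in unitI R) `|(phi z - g n z)%:E|)%E| < e / 2.
    by near: n.
  by rewrite sub0r normrN; exact: le_lt_trans (ler_norm _).
have mg : measurable_fun setT (g n) by exact: continuous_measurable_fun.
exists ((fun=> -1) \max ((fun=> 1) \min g n)); split.
- apply: max_fun_continuous; first by move=> ?; exact: cvg_cst.
  by apply: min_fun_continuous => //; move=> ?; exact: cvg_cst.
- move=> t /=; rewrite ler_norml le_max lexx/= ge_max ge_min lexx/= andbT.
  by rewrite (le_trans _ ler01)// oppr_le0.
have -> : e = 2 * (e / 2) by rewrite mulrC divfK.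
rewrite EFinM; apply: (@le_trans _ _
    (2%:E * (\int[mu]_(z in unitI R) `|(phi z - g n z)%:E|))%E); last first.
  by rewrite lee_pmul2l// -(fineK nfin) lee_fin ltW.
rewrite -ge0_integralZl_EFin//; last first.
  apply/measurable_funTS/measurable_EFinP; apply: measurableT_comp => //.
  exact: measurable_funB.
apply: ge0_le_integral => //.
- by move=> t _; rewrite lee_fin sqr_ge0.
- apply/measurable_funTS/measurable_EFinP; apply: measurable_funX.
  apply: measurable_funB => //; apply: measurable_maxr => //; exact: measurable_minr.
- apply/measurable_funTS/measurable_EFinP; apply: measurable_funM => //.
  by apply: measurableT_comp => //; exact: measurable_funB.
move=> t _ /=; rewrite -EFinM lee_fin.
by have := phi1 t; rewrite ler_norml => /andP[]; exact: sqr_sub_clamp_le.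
Unshelve. all: by end_near. Qed.

Lemma primitive_dist a b (d : R) t : density a -> density b ->
  (\int[mu]_x (`|a x - b x|)%:E <= d%:E)%E -> `|primitive a t - primitive b t| <= d.
Proof.
move=> /density_integrable ia /density_integrable ib abd.
have iat : mu.-integrable `]-oo, t] (EFin \o a) by exact: integrableS ia.
have ibt : mu.-integrable `]-oo, t] (EFin \o b) by exact: integrableS ib.
have iab : mu.-integrable setT (EFin \o (fun x => a x - b x)).
  exact: (integrableB measurableT ia ib).
have iabt : mu.-integrable `]-oo, t] (EFin \o (fun x => a x - b x)).
  exact: integrableS iab.
rewrite /primitive -RintegralB// -lee_fin EFin_normr_Rintegral//.
apply: le_trans abd; case/integrableP: iab => mab _.
have mt : measurable (`]-oo, t]%classic : set (measurableTypeR R)).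
  exact: measurable_itv.
apply: (le_trans (le_abse_integral mu mt (measurable_funTS mab))).
by apply: ge0_subset_integral => //; exact: measurableT_comp.
Qed.

Lemma measurable_sqrt_mul_comp a phi g : measurable_fun setT a ->
  measurable_fun setT phi -> measurable_fun setT g ->
  measurable_fun setT (fun t => Num.sqrt (a t) * phi (g t)).
Proof.
move=> ma mphi mg; apply: measurable_funM; last exact: measurableT_comp mphi mg.
apply: (@measurableT_comp _ _ _ _ _ _ (Num.sqrt : R -> R)) => //.
by apply: continuous_measurable_fun => x; exact: sqrt_continuous.
Qed.

Lemma sqr_sum4_le (x y z w : R) :
  (x + y + z + w) ^+ 2 <= 4 * (x ^+ 2 + y ^+ 2 + z ^+ 2 + w ^+ 2).
Proof.
have := sqr_ge0 (x - y); have := sqr_ge0 (x - z); have := sqr_ge0 (x - w).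
have := sqr_ge0 (y - z); have := sqr_ge0 (y - w); have := sqr_ge0 (z - w).
rewrite !expr2; lra.
Qed.

(** Trading [phi] for a continuous [p] costs the same for every density, by
    [ge0_integral_density_comp]. For [p], uniform continuity suffices, since densities close in L1
    have uniformly close primitives. *)
Theorem reparam_scalar_stable phi (e : R) : measurable_fun setT phi ->
  (forall t, `|phi t| <= 1) -> 0 < e ->
  exists2 d : R, 0 < d & forall a b, density a -> density b ->
    (\int[mu]_t (`|a t - b t|)%:E <= d%:E)%E ->
    (\int[mu]_t ((Num.sqrt (a t) * phi (primitive a t)
       - Num.sqrt (b t) * phi (primitive b t)) ^+ 2)%:E <= e%:E)%E.
Proof.
(* Four error terms, each of integral at most h, and the factor 4 of [sqr_sum4_le]. *)
move=> mphi phi1 e0; pose h := e / 16.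
have h0 : 0 < h by rewrite divr_gt0.
have [p [cp p1 pphi]] := continuous_approximation mphi phi1 h0.
have sh0 : 0 < Num.sqrt h by rewrite sqrtr_gt0.
have [d d0 dP] := unif_continuous_unitI cp sh0.
(* Half of [d], because [primitive_dist] is not strict whereas the modulus of continuity requires a
   distance below [d]. *)
exists (Num.min h (d / 2)); first by rewrite lt_min h0 divr_gt0.
move=> a b da db abd.
have abh : (\int[mu]_t (`|a t - b t|)%:E <= h%:E)%E.
  by apply: (le_trans abd); rewrite lee_fin ge_min lexx.
have abd2 : (\int[mu]_t (`|a t - b t|)%:E <= (d / 2)%:E)%E.
  by apply: (le_trans abd); rewrite lee_fin ge_min lexx orbT.
have [ma a0 aI a1] := da; have [mb b0 bI b1] := db.
have mp : measurable_fun setT p by exact: continuous_measurable_fun.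
have mGa := measurable_density_primitive da.
have mGb := measurable_density_primitive db.
pose psi t := (phi t - p t) ^+ 2.
have mpsi : measurable_fun setT psi by apply: measurable_funX; exact: measurable_funB.
have psi0 t : 0 <= psi t by exact: sqr_ge0.
have int_psi c : density c -> (\int[mu]_t (psi (primitive c t) * c t)%:E <= h%:E)%E.
  move=> dc; apply: le_trans pphi.
  rewrite [leLHS](_ : _ =
      \int[mu]_t ((EFin \o psi) (primitive c t) * (c t)%:E))%E; last first.
    by apply: eq_integral => t _; rewrite EFinM.
  rewrite ge0_integral_density_comp//; exact/measurable_EFinP.
have mpsia : measurable_fun setT (fun t => psi (primitive a t) * a t).
  by apply: measurable_funM => //; exact: measurableT_comp mpsi mGa.
have mpsib : measurable_fun setT (fun t => psi (primitive b t) * b t).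
  by apply: measurable_funM => //; exact: measurableT_comp mpsi mGb.
have mab : measurable_fun setT (fun t => `|a t - b t|).
  by apply: measurableT_comp => //; exact: measurable_funB.
have mhb : measurable_fun setT (fun t => h * b t) by exact: measurable_funM.
pose bound t : R := (psi (primitive a t) * a t + psi (primitive b t) * b t)
  + (`|a t - b t| + h * b t).
have mbound : measurable_fun setT bound.
  by do 2 apply: measurable_funD => //; apply: measurable_funD.
have bound0 t : 0 <= bound t.
  by rewrite !addr_ge0// mulr_ge0// ltW.
have pointwise t : (Num.sqrt (a t) * phi (primitive a t)
       - Num.sqrt (b t) * phi (primitive b t)) ^+ 2 <= 4 * bound t.
  have Gab : `|p (primitive a t) - p (primitive b t)| < Num.sqrt h.
    have G01 c : density c -> unitI R (primitive c t).
      by move=> dc; rewrite /unitI/= in_itv/=; apply/andP; exact: density_primitive_itv.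
    apply: dP; [exact: G01|exact: G01|].
    by apply: le_lt_trans (primitive_dist t da db abd2) _; rewrite ltr_pdivrMr// ltr_pMr// ltr1n.
  have sqrAB := sqr_sqrtB_le (a0 t) (b0 t).
  have sqrA := sqr_sqrtr (a0 t); have sqrB := sqr_sqrtr (b0 t).
  have p1a := p1 (primitive a t).
  rewrite /bound /psi; move: Gab sqrAB sqrA sqrB p1a.
  move: (phi _) (phi _) (p _) (p _) (Num.sqrt (a t)) (Num.sqrt (b t)) => y x v u A B.
  move=> uv AB AA BB u1.
  (* The terms replace [phi] by [p], then sqrt a by sqrt b, then move the argument of [p], then
     return to [phi]. Each square contributes one summand of [bound]. *)
  have -> : A * x - B * y = A * (x - u) + (A - B) * u + B * (u - v) + B * (v - y) by ring.
  apply: (le_trans (sqr_sum4_le _ _ _ _)); rewrite ler_pM2l// !exprMn AA BB.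
  have h1 : (A - B) ^+ 2 * u ^+ 2 <= `|a t - b t|.
    apply: (le_trans _ AB); rewrite ler_piMr ?sqr_ge0// -real_normK ?num_real//.
    by rewrite expr_le1.
  have h2 : b t * (u - v) ^+ 2 <= h * b t.
    rewrite mulrC ler_wpM2r// -real_normK ?num_real// -(sqr_sqrtr (ltW h0)).
    by rewrite lerXn2r ?nnegrE// ltW.
  have -> : (v - y) ^+ 2 = (y - v) ^+ 2 by ring.
  lra.
apply: (@le_trans _ _ (\int[mu]_t (4%:E * (bound t)%:E))%E).
  apply: ge0_le_integral => //.
  - by move=> t _; rewrite lee_fin sqr_ge0.
  - apply/measurable_EFinP; apply: measurable_funX; apply: measurable_funB.
      exact: (measurable_sqrt_mul_comp ma mphi mGa).
    exact: (measurable_sqrt_mul_comp mb mphi mGb).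
  - by apply/measurable_EFinP; exact: measurable_funM.
  - by move=> t _; rewrite -EFinM lee_fin.
have mE (f : R -> R) : measurable_fun setT f -> measurable_fun setT (EFin \o f).
  by move=> mf; exact/measurable_EFinP.
rewrite (@ge0_integralZl_EFin _ _ _ mu _ measurableT _ _ (mE _ mbound))//; last first.
  by move=> t _; rewrite lee_fin.
have -> : e = 4 * ((h + h) + (h + h)) by rewrite /h; field.
rewrite EFinM lee_pmul2l//.
have splitD (f g : R -> R) : measurable_fun setT f -> measurable_fun setT g ->
    (forall t, 0 <= f t) -> (forall t, 0 <= g t) ->
    (\int[mu]_t (f t + g t)%:E = \int[mu]_t (f t)%:E + \int[mu]_t (g t)%:E)%E.
  move=> mf mg f0 g0.
  rewrite -(@ge0_integralD _ _ _ mu _ measurableT _ _ _ (mE _ mf) _ (mE _ mg))//.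
  - by move=> t _; rewrite lee_fin.
  - by move=> t _; rewrite lee_fin.
have pa0 t : 0 <= psi (primitive a t) * a t by exact: mulr_ge0.
have pb0 t : 0 <= psi (primitive b t) * b t by exact: mulr_ge0.
have hb0 t : 0 <= h * b t by rewrite mulr_ge0// ltW.
rewrite /bound splitD; [|exact: measurable_funD|exact: measurable_funD
  |by move=> t; exact: addr_ge0|by move=> t; exact: addr_ge0].
rewrite (splitD _ _ mpsia mpsib)// (splitD _ _ mab mhb)//.
rewrite !EFinD; apply: leeD; apply: leeD; [exact: int_psi|exact: int_psi|exact: abh|].
rewrite (_ : (\int[mu]_t _)%E = (\int[mu]_t (h%:E * (b t)%:E))%E); last first.
  by apply: eq_integral => t _; rewrite EFinM.
rewrite (@ge0_integralZl_EFin _ _ _ mu _ measurableT _ _ (mE _ mb))//; last by exact: ltW.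
  by rewrite b1 mule1.
by move=> t _; rewrite lee_fin.
Qed.

End stability.

(** * Squared norm *)

Section L2_square.
Context {R : realType} {N : nat}.
Implicit Types (f g : R -> 'rV[R]_N) (x y : L2 R N).
Local Notation mu := (@lebesgue_measure R).

Definition L2sq f : \bar R := (\int[mu]_(t in unitI R) (enorm (f t) ^+ 2)%:E)%E.

Lemma measurable_unitI : measurable (unitI R : set (measurableTypeR R)).
Proof. exact: measurable_itv. Qed.

Lemma L2sq_ge0 f : (0 <= L2sq f)%E.
Proof. by apply: integral_ge0 => t _; rewrite lee_fin sqr_ge0. Qed.

Lemma L2norm_sqr f : (L2norm f `^ 2 = L2sq f)%E.
Proof.
rewrite /L2norm powR_Lnorm ?pnatr_eq0// /L2sq [RHS]integral_mkcond.
apply: eq_integral => t _ /=; rewrite !patchE; case: ifPn => _.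
  by rewrite ger0_norm ?enorm_ge0// powR_mulrn// enorm_ge0.
by rewrite normr0 powR0// pnatr_eq0.
Qed.

Lemma L2norm_lty f : (L2sq f < +oo)%E -> (L2norm f < +oo)%E.
Proof.
by rewrite -L2norm_sqr; apply: lty_poweRy; rewrite pnatr_eq0.
Qed.

Lemma L2dist_sqr x y : ((L2dist x y ^+ 2)%:E = L2sq (fun t => (x t - y t)%R))%E.
Proof.
rewrite -L2norm_sqr -L2dist_EFin poweR_EFin powR_mulrn//.
by rewrite -lee_fin L2dist_EFin L2norm_ge0.
Qed.

Lemma measurable_enorm_sqr f : L2measurable f ->
  measurable_fun (unitI R) (fun t => enorm (f t) ^+ 2).
Proof.
move=> mf; apply: (eq_measurable_fun (fun t => \sum_(i < N) f t 0 i ^+ 2)).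
  by move=> t _; rewrite sqr_enorm.
by apply: measurable_sum => i; apply: measurable_funX; exact: mf.
Qed.

Lemma L2sq_sum f : L2measurable f ->
  (L2sq f = \sum_(i < N) \int[mu]_(t in unitI R) (f t 0 i ^+ 2)%:E)%E.
Proof.
move=> mf; rewrite -ge0_integral_sum//.
- by apply: eq_integral => t _; rewrite sqr_enorm sumEFin.
- exact: measurable_unitI.
- by move=> i; apply/measurable_EFinP; apply: measurable_funX; exact: mf.
- by move=> i t _; rewrite lee_fin sqr_ge0.
Qed.

Lemma L2sq_triangle f g : L2measurable f -> L2measurable g ->
  (L2sq (fun t => (f t + g t)%R) <= 2%:E * L2sq f + 2%:E * L2sq g)%E.
Proof.
move=> mf mg.
have mfg : L2measurable (fun t => f t + g t).
  move=> i; rewrite [X in measurable_fun _ X](_ : _ = (fun t => f t 0 i + g t 0 i)).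
    exact: measurable_funD.
  by apply/funext => t; rewrite !mxE.
have mE (h : R -> 'rV[R]_N) : L2measurable h ->
    measurable_fun (unitI R) (fun t => (enorm (h t) ^+ 2)%:E).
  by move=> mh; apply/measurable_EFinP; exact: measurable_enorm_sqr.
have m2E (h : R -> 'rV[R]_N) : L2measurable h ->
    measurable_fun (unitI R) (fun t => (2 * enorm (h t) ^+ 2)%:E).
  move=> mh; apply/measurable_EFinP; apply: measurable_funM => //.
  exact: measurable_enorm_sqr.
have Z (h : R -> 'rV[R]_N) : L2measurable h ->
    (2%:E * L2sq h = \int[mu]_(t in unitI R) (2 * enorm (h t) ^+ 2)%:E)%E.
  move=> mh; rewrite /L2sq -(@ge0_integralZl_EFin _ _ _ mu _ measurable_unitI _ _ (mE _ mh))//.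
  by move=> t _; rewrite lee_fin sqr_ge0.
rewrite !Z// -(@ge0_integralD _ _ _ mu _ measurable_unitI _ _ _ (m2E _ mf) _ (m2E _ mg))//;
  [|by move=> t _; rewrite lee_fin mulr_ge0// sqr_ge0..].
apply: ge0_le_integral.
- exact: measurable_unitI.
- by move=> t _; rewrite lee_fin sqr_ge0.
- exact: mE.
- by apply: emeasurable_funD; exact: m2E.
- move=> t _; rewrite -EFinD lee_fin.
  apply: (@le_trans _ _ ((enorm (f t) + enorm (g t)) ^+ 2)).
    by rewrite lerXn2r ?nnegrE ?addr_ge0 ?enorm_ge0 ?ler_enormD.
  have := sqr_ge0 (enorm (f t) - enorm (g t)); rewrite sqrrB sqrrD; lra.
Qed.

Lemma eq_ae_L2sq f g : L2measurable f -> L2measurable g ->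
  {ae mu, forall t, unitI R t -> f t = g t} -> L2sq f = L2sq g.
Proof.
move=> mf mg fg; apply: ae_eq_integral.
- exact: measurable_unitI.
- by apply/measurable_EFinP; exact: measurable_enorm_sqr.
- by apply/measurable_EFinP; exact: measurable_enorm_sqr.
- by apply: (filterS_ae fg) => t /[apply] ->.
Qed.

Lemma L2sq_eq0 f : L2measurable f -> L2sq f = 0%E ->
  {ae mu, forall t, unitI R t -> f t = 0}.
Proof.
move=> mf f0.
have : ae_eq mu (unitI R) (fun t => (enorm (f t) ^+ 2)%:E) (cst 0%E).
  apply/ae_eq_integral_abs; first exact: measurable_unitI.
    by apply/measurable_EFinP; exact: measurable_enorm_sqr.
  by rewrite -[RHS]f0; apply: eq_integral => t _ /=; rewrite ger0_norm// sqr_ge0.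
move=> h; apply: (filterS_ae h) => t /[apply] -[] /eqP.
by rewrite sqrf_eq0 => /eqP/enorm_eq0.
Qed.

(** With c = |u - v|, the left side is at most c^2 + 2 c |v|, and the weighted AM-GM inequality
    splits the cross term. The free weight s replaces the Cauchy-Schwarz inequality for integrals;
    it is later set to the bound on the L2 distance. *)
Lemma enorm_sqrB (u v : 'rV[R]_N) (s : R) : 0 < s ->
  `|enorm u ^+ 2 - enorm v ^+ 2| <= (1 + s^-1) * enorm (u - v) ^+ 2 + s * enorm v ^+ 2.
Proof.
move=> s0; have uv := ler_enormD (u - v) v; rewrite subrK in uv.
have vu : enorm v <= enorm (u - v) + enorm u.
  by have := ler_enormD (v - u) u; rewrite subrK -(enormN (v - u)) opprB.
have := enorm_ge0 (u - v); have := enorm_ge0 u; have := enorm_ge0 v.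
move: (enorm u) (enorm v) (enorm (u - v)) uv vu => a b c ab ba b0 a0 c0.
have amgm : 2 * (b * c) <= s * b ^+ 2 + s^-1 * c ^+ 2.
  rewrite -subr_ge0 (_ : _ - _ = s^-1 * (s * b - c) ^+ 2); last by field; lra.
  by rewrite mulr_ge0 ?sqr_ge0// invr_ge0 ltW.
rewrite ler_norml; apply/andP; split; nra.
Qed.

End L2_square.

(** * Borel representatives *)

Section borel_representative.
Context {R : realType} {N : nat}.
Implicit Types (q r : R -> 'rV[R]_N) (a b g : R -> R).
Local Notation mu := (@lebesgue_measure R).

(** Borel coordinates stay measurable after composition with a primitive, and the bound by 1 holds
    everywhere because [reparam_scalar_stable] asks for it at every point. *)
Definition borel_unit_field r := [/\ forall i, measurable_fun setT (fun t => r t 0 i),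
  forall t i, `|r t 0 i| <= 1 & {ae mu, forall t, unitI R t -> enorm (r t) = 1}].

Lemma borel_unit_field_exists q : is_L2 q ->
  {ae mu, forall t, unitI R t -> enorm (q t) = 1} ->
  exists2 r, borel_unit_field r & {ae mu, forall t, unitI R t -> q t = r t}.
Proof.
move=> [x qx] q1.
(* The coordinates of a unit vector already lie in [-1, 1], so clamping changes [x] only on a null
   subset of I. *)
pose c i t : R := Num.max (-1) (Num.min 1 (x t 0 i)).
pose r t : 'rV[R]_N := \row_i ((c i \_ (unitI R)) t).
have qr : {ae mu, forall t, unitI R t -> q t = r t}.
  apply: (filterS2_ae qx q1) => t + + It => /(_ It) qxt /(_ It) qt1.
  apply/rowP => i; rewrite mxE patchE mem_set// /c -qxt.
  have : (q t 0 i) ^+ 2 <= 1.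
    rewrite -(expr1n R 2) -qt1 sqr_enorm (bigD1 i)//= lerDl.
    by apply: sumr_ge0 => j _; exact: sqr_ge0.
  rewrite -real_normK ?num_real// expr_le1// ler_norml => /andP[h1 h2].
  by rewrite min_r// max_r.
exists r => //; split.
- move=> i; rewrite [X in measurable_fun _ X](_ : _ = c i \_ (unitI R)); last first.
    by apply/funext => t; rewrite mxE.
  apply/(measurable_restrictT _ _).1; first exact: measurable_itv.
  apply: measurable_maxr => //; apply: measurable_minr => //.
  exact: (L2fun_measurable x i).
- move=> t i; rewrite mxE patchE; case: ifPn => _; last by rewrite normr0.
  rewrite /c ler_norml le_max lexx/= ge_max ge_min lexx/= andbT.
  by rewrite (le_trans _ ler01)// oppr_le0.
- by apply: (filterS2_ae qr q1) => t + + It => /(_ It) <- /(_ It).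
Qed.

Context (r : R -> 'rV[R]_N) (fr : borel_unit_field r).

Let mr i : measurable_fun setT (fun t => r t 0 i). Proof. by case: fr. Qed.
Let r1 t i : `|r t 0 i| <= 1. Proof. by case: fr. Qed.
Let ae_r1 : {ae mu, forall t, unitI R t -> enorm (r t) = 1}. Proof. by case: fr. Qed.

(** The T of the overview for a Borel representative, with [a] itself in place of the derivative of
    its primitive. *)
Definition transport a : R -> 'rV[R]_N := fun t => Num.sqrt (a t) *: r (primitive a t).

Lemma density_primitive_unitI a t : density a -> unitI R (primitive a t).
Proof.
by move=> da; rewrite /unitI/= in_itv/=; apply/andP; exact: density_primitive_itv.
Qed.

Lemma transport_measurable a : density a -> L2measurable (transport a).
Proof.
move=> da i; have [ma _ _ _] := da.
rewrite [X in measurable_fun _ X](_ : _ =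
    (fun t => Num.sqrt (a t) * r (primitive a t) 0 i)); last first.
  by apply/funext => t; rewrite mxE.
apply: measurable_funTS; apply: (measurable_sqrt_mul_comp ma (mr i)).
exact: measurable_density_primitive.
Qed.

(** The form in which a statement valid almost everywhere on I survives composition with A: the
    points where it fails carry the weight a = 0. *)
Lemma ae_density_comp a (P : R -> Prop) : density a ->
  {ae mu, forall t, unitI R t -> P t} ->
  {ae mu, forall t, P (primitive a t) \/ a t = 0}.
Proof.
move=> da [Z [mZ Z0 PZ]].
apply: (filterS_ae (density_null_preimage da mZ Z0)) => t at0.
have [Pt|nPt] := pselect (P (primitive a t)); first by left.
right; apply: at0; apply: PZ => /= H; apply/nPt/H.
exact: density_primitive_unitI.
Qed.

Lemma enorm_transport a : density a ->
  {ae mu, forall t, unitI R t -> enorm (transport a t) ^+ 2 = a t}.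
Proof.
move=> da; have [_ a0 _ _] := da.
apply: (filterS_ae (ae_density_comp da ae_r1)) => t H _.
rewrite sqr_enorm; under eq_bigr do rewrite mxE exprMn sqr_sqrtr//.
rewrite -mulr_sumr -sqr_enorm.
by case: H => ->; rewrite ?expr1n ?mulr1// mul0r.
Qed.

Lemma L2sq_transport a : density a -> L2sq (transport a) = 1%E.
Proof.
move=> da; have [ma a0 aI a1] := da.
rewrite -a1 [RHS](_ : _ = \int[mu]_(t in unitI R) (a t)%:E)%E; last first.
  rewrite [RHS]integral_mkcond; apply: eq_integral => t _; rewrite patchE.
  by case: ifPn => //; rewrite notin_setE => /aI ->.
apply: ae_eq_integral.
- exact: measurable_unitI.
- by apply/measurable_EFinP; apply: measurable_enorm_sqr; exact: transport_measurable.
- by apply/measurable_funTS/measurable_EFinP.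
- by apply: (filterS_ae (enorm_transport da)) => t /[apply] ->.
Qed.

Lemma transport_L2 a : density a -> exists x : L2 R N, x = transport a :> (R -> _).
Proof.
move=> da; have fin : (L2norm (transport a) < +oo)%E.
  by apply: L2norm_lty; rewrite L2sq_transport// ltry.
by exists (MkL2 (transport_measurable da) fin).
Qed.

(** Where A meets the exceptional set of q = r, the density is zero, and the factor sqrt a
    annihilates both sides. *)
Lemma reparam_transport q g a : {ae mu, forall t, unitI R t -> q t = r t} ->
  density a -> (forall t, unitI R t -> g t = primitive a t) ->
  {ae mu, forall t, unitI R t -> derive1 g t = a t} ->
  {ae mu, forall t, unitI R t -> reparam q g t = transport a t}.
Proof.
move=> qr da gE g'E.
apply: (filterS2_ae (ae_density_comp da qr) g'E) => t H + It => /(_ It) g't.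
rewrite /reparam /transport g't gE//.
by case: H => [->//|->]; rewrite sqrtr0 !scale0r.
Qed.

Lemma transport_stable (e : R) : 0 < e -> exists2 d : R, 0 < d &
  forall a b, density a -> density b ->
    (\int[mu]_t (`|a t - b t|)%:E <= d%:E)%E ->
    (L2sq (fun t => (transport a t - transport b t)%R) <= e%:E)%E.
Proof.
(* The error is shared among the coordinates, with [N.+1] because [N] may be 0; the initial value 1
   of the minimum below covers that case as well. *)
move=> e0; have eN : 0 < e / N.+1%:R by rewrite divr_gt0.
have /choice[D DP] i : exists d : R, 0 < d /\
   forall a b, density a -> density b ->
    (\int[mu]_t (`|a t - b t|)%:E <= d%:E)%E ->
    (\int[mu]_t ((Num.sqrt (a t) * r (primitive a t) 0 i
       - Num.sqrt (b t) * r (primitive b t) 0 i) ^+ 2)%:E <= (e / N.+1%:R)%:E)%E.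
  by have [d d0 dP] := reparam_scalar_stable (mr i) (fun t => r1 t i) eN; exists d.
exists (\big[Num.min/1]_i D i).
  apply: (big_ind (fun y : R => 0 < y)) => // [x y x0 y0|i _].
    by rewrite lt_min x0.
  by have [] := DP i.
move=> a b da db abd.
have mab : L2measurable (fun t => transport a t - transport b t).
  by apply: L2measurableB; exact: transport_measurable.
rewrite L2sq_sum//; apply: (@le_trans _ _ (\sum_(i < N) (e / N.+1%:R)%:E)%E); last first.
  rewrite sumEFin lee_fin sumr_const card_ord -[leLHS]mulr_natr mulrAC ler_pdivrMr//.
  by rewrite ler_pM2l// ler_nat.
apply: lee_sum => i _; have [_ /(_ a b da db) H] := DP i.
apply: le_trans (H _); last first.
  by apply: (le_trans abd); rewrite lee_fin; exact: bigmin_le.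
rewrite [leLHS](_ : _ = \int[mu]_(t in unitI R) ((Num.sqrt (a t) * r (primitive a t) 0 i
    - Num.sqrt (b t) * r (primitive b t) 0 i) ^+ 2)%:E)%E; last first.
  by apply: eq_integral => t _; rewrite !mxE.
apply: ge0_subset_integral => //; first exact: measurable_unitI.
  have [ma _ _ _] := da; have [mb _ _ _] := db.
  apply/measurable_EFinP; apply: measurable_funX; apply: measurable_funB.
    exact: (measurable_sqrt_mul_comp ma (mr i) (measurable_density_primitive da)).
  exact: (measurable_sqrt_mul_comp mb (mr i) (measurable_density_primitive db)).
by move=> t _; rewrite lee_fin sqr_ge0.
Qed.

End borel_representative.

(** * The closure of the orbit *)

Section closure_of_orbit.
Context {R : realType} {N : nat}.
Implicit Types (q r : R -> 'rV[R]_N) (a b g : R -> R) (x y : L2 R N).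
Local Notation mu := (@lebesgue_measure R).

Lemma closure_L2dist (A : set (L2 R N)) x :
  closure A x <-> forall e : R, 0 < e -> exists2 y, A y & L2dist x y < e.
Proof.
split=> [Ax e e0|Ax B /nbhs_ballP[e /= e0 eB]].
  by have [y [Ay xy]] := Ax _ (nbhsx_ballx x e e0); exists y.
by have [y Ay xy] := Ax e e0; exists y; split => //; exact: eB.
Qed.

Lemma L2sq_L2dist_lt x y (e : R) : 0 < e ->
  (L2sq (fun t => (x t - y t)%R) < (e ^+ 2)%:E)%E -> L2dist x y < e.
Proof.
move=> e0; rewrite -L2dist_sqr lte_fin ltr_pXn2r// ?nnegrE ?(ltW e0)//.
by rewrite -lee_fin L2dist_EFin L2norm_ge0.
Qed.

Lemma L2sq_L2dist_le x y (e : R) : L2dist x y < e ->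
  (L2sq (fun t => (x t - y t)%R) <= (e ^+ 2)%:E)%E.
Proof.
move=> xy; rewrite -L2dist_sqr lee_fin.
have d0 : 0 <= L2dist x y by rewrite -lee_fin L2dist_EFin L2norm_ge0.
by rewrite lerXn2r ?nnegrE ?(ltW xy)// ltW// (le_lt_trans d0).
Qed.

Lemma density_indic : density (\1_(unitI R) : R -> R).
Proof.
split.
- by apply: measurable_indic; exact: measurable_itv.
- by move=> t; rewrite indicE.
- by move=> t It; rewrite indicE memNset.
- rewrite (integral_indic _ measurableT); last exact: measurable_unitI.
  rewrite setIT.
  by rewrite [LHS]lebesgue_measure_itv/= lte_fin ltr01 oppr0 adde0.
Qed.

Lemma density_convex a b (s : R) : 0 <= s -> s <= 1 -> density a -> density b ->
  density (fun t => (1 - s) * a t + s * b t).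
Proof.
move=> s0 s1 [ma a0 aI a1] [mb b0 bI b1].
have s'0 : 0 <= 1 - s by rewrite subr_ge0.
split.
- by apply: measurable_funD; apply: measurable_funM.
- by move=> t; rewrite addr_ge0// mulr_ge0.
- by move=> t It; rewrite aI// bI// !mulr0 addr0.
have mE (c : R) (f : R -> R) : measurable_fun setT f ->
    measurable_fun setT (fun t => (c%:E * (f t)%:E)%E).
  move=> mf; have : measurable_fun setT (EFin \o (fun t => c * f t)).
    by apply/measurable_EFinP; exact: measurable_funM.
  by apply: eq_measurable_fun => t _; rewrite /= EFinM.
have pos (c : R) (f : R -> R) : 0 <= c -> (forall t, 0 <= f t) ->
    forall t : R, setT t -> (0 <= c%:E * (f t)%:E)%E.
  by move=> c0 f0 t _; rewrite -EFinM lee_fin mulr_ge0.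
rewrite (_ : (\int[mu]_t _)%E =
    \int[mu]_t ((1 - s)%:E * (a t)%:E + s%:E * (b t)%:E))%E; last first.
  by apply: eq_integral => t _; rewrite EFinD !EFinM.
rewrite (@ge0_integralD _ _ _ mu _ measurableT _ _ (pos _ _ s'0 a0) (mE _ _ ma)
  (pos _ _ s0 b0) (mE _ _ mb)).
rewrite (@ge0_integralZl_EFin _ _ _ mu _ measurableT)//;
  [|by move=> t _; rewrite lee_fin|exact/measurable_EFinP].
rewrite (@ge0_integralZl_EFin _ _ _ mu _ measurableT)//;
  [|by move=> t _; rewrite lee_fin|exact/measurable_EFinP].
by rewrite a1 b1 !mule1 -EFinD subrK.
Qed.

Lemma density_dist a b : density a -> density b ->
  (\int[mu]_t (`|a t - b t|)%:E <= 2%:E)%E.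
Proof.
move=> [ma a0 aI a1] [mb b0 bI b1].
apply: (@le_trans _ _ (\int[mu]_t ((a t)%:E + (b t)%:E))%E).
  apply: ge0_le_integral => //.
  - by apply/measurable_EFinP; apply: measurableT_comp => //; exact: measurable_funB.
  - by apply/measurable_EFinP; exact: measurable_funD.
  - move=> t _; rewrite -EFinD lee_fin; apply: (le_trans (ler_normB _ _)).
    by rewrite !ger0_norm.
rewrite (@ge0_integralD _ _ _ mu _ measurableT)//; [|by move=> t _; rewrite lee_fin
  |exact/measurable_EFinP|by move=> t _; rewrite lee_fin|exact/measurable_EFinP].
by rewrite a1 b1 -EFinD (_ : 1 + 1 = 2).
Qed.

Lemma density_Gamma a : density a ->
  {ae mu, forall t, unitI R t -> 0 < a t} -> Gamma (primitive a).
Proof.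
move=> da a0; split; first exact: density_Gamma_tilde.
apply: (filterS2_ae a0 (primitive_derive (density_integrable da))) => t at0 [dt ->] It.
by split => //; exact: at0.
Qed.

Context (q r : R -> 'rV[R]_N) (fr : borel_unit_field r).
Context (qr : {ae mu, forall t, unitI R t -> q t = r t}).

Lemma reparam_primitive a : density a ->
  {ae mu, forall t, unitI R t -> reparam q (primitive a) t = transport r a t}.
Proof.
move=> da; apply: (reparam_transport qr da) => //.
by apply: (filterS_ae (primitive_derive (density_integrable da))) => t [].
Qed.

Lemma orbit_tilde_closure x :
  reparam_orbit q Gamma_tilde x -> closure (reparam_orbit q Gamma) x.
Proof.
move=> [g Gg xg]; have [a [da gE g'E]] := Gamma_tilde_density Gg.
have xa : {ae mu, forall t, unitI R t -> x t = transport r a t}.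
  apply: (filterS2_ae xg (reparam_transport qr da gE g'E)) => t + + It.
  by move=> /(_ It) -> /(_ It).
apply/closure_L2dist => e e0.
(* Stability gives a non-strict bound, and half of e^2 makes the distance strictly less than e. *)
have e2 : 0 < e ^+ 2 / 2 by rewrite divr_gt0// exprn_gt0.
have [d d0 dP] := transport_stable fr e2.
(* Mixing in the uniform density with weight s moves [a] by s times an L1 distance of at most 2, and
   2 s <= d; s <= 1 keeps the combination convex. *)
pose s := Num.min 1 (d / 2).
have s0 : 0 < s by rewrite lt_min ltr01 divr_gt0.
have s1 : s <= 1 by rewrite ge_min lexx.
have sd : s * 2 <= d by rewrite -ler_pdivlMr// ge_min lexx orbT.
have db := density_convex (ltW s0) s1 da density_indic.
set b := (fun t => _) in db.
have [_ a0 _ _] := da.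
have Gb : Gamma (primitive b).
  apply: density_Gamma => //; apply: aeW => t It.
  rewrite /b indicE mem_set// mulr1 ltr_wpDl//.
  by rewrite mulr_ge0// subr_ge0.
have [y yb] := transport_L2 fr db.
exists y.
  exists (primitive b) => //.
  by apply: (filterS_ae (reparam_primitive db)) => t H It; rewrite yb H.
apply: L2sq_L2dist_lt => //.
rewrite (@eq_ae_L2sq _ _ _ (fun t => transport r a t - transport r b t)).
- apply: (@le_lt_trans _ _ (e ^+ 2 / 2)%:E); last first.
    by rewrite lte_fin ltr_pdivrMr// ltr_pMr ?exprn_gt0// ltr1n.
  apply: dP => //; apply: (@le_trans _ _ (s%:E * 2%:E)%E); last by rewrite -EFinM lee_fin.
  have [ma _ _ _] := da; have mi : measurable_fun setT (\1_(unitI R) : R -> R).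
    by have [] := density_indic.
  rewrite (_ : (\int[mu]_t _)%E =
      \int[mu]_t (s%:E * (`|a t - \1_(unitI R) t|)%:E))%E; last first.
    apply: eq_integral => t _; rewrite -EFinM; congr EFin.
    by rewrite -[s in RHS]gtr0_norm// -normrM; congr `| _ |; rewrite /b; ring.
  rewrite (@ge0_integralZl_EFin _ _ _ mu _ measurableT)//.
  + by rewrite lee_pmul2l//; apply: density_dist => //; exact: density_indic.
  + apply/measurable_EFinP; apply: measurableT_comp => //; exact: measurable_funB.
  + exact: ltW.
- by apply: L2measurableB; exact: L2fun_measurable.
- by apply: L2measurableB; exact: transport_measurable.
- by apply: (filterS_ae xa) => t H It; rewrite yb H.
Qed.

End closure_of_orbit.

(** * Limits of the orbit are reparametrizations by their own energy *)

Section closure_of_orbit.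
Context {R : realType} {N : nat}.
Implicit Types (a b g : R -> R) (x y : L2 R N).
Local Notation mu := (@lebesgue_measure R).
Context (q r : R -> 'rV[R]_N) (fr : borel_unit_field r).
Context (qr : {ae mu, forall t, unitI R t -> q t = r t}).

Lemma integral_enorm_sqrB_le (f g : R -> 'rV[R]_N) (s : R) : L2measurable f ->
  L2measurable g -> 0 < s ->
  (\int[mu]_(t in unitI R) (`|enorm (f t) ^+ 2 - enorm (g t) ^+ 2|)%:E <=
   (1 + s^-1)%:E * L2sq (fun t => (f t - g t)%R) + s%:E * L2sq g)%E.
Proof.
move=> mf mg s0; have mI := @measurable_unitI R.
have s'0 : 0 <= 1 + s^-1 by rewrite addr_ge0// invr_ge0 ltW.
have mfg := L2measurableB mf mg.
have Z (c : R) (h : R -> 'rV[R]_N) : L2measurable h -> 0 <= c ->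
    (c%:E * L2sq h = \int[mu]_(t in unitI R) (c * enorm (h t) ^+ 2)%:E)%E.
  move=> mh c0; rewrite /L2sq -(@ge0_integralZl_EFin _ _ _ mu _ mI)//.
  - by move=> t _; rewrite lee_fin sqr_ge0.
  - by apply/measurable_EFinP; exact: measurable_enorm_sqr.
have mZ (c : R) (h : R -> 'rV[R]_N) : L2measurable h ->
    measurable_fun (unitI R) (fun t => (c * enorm (h t) ^+ 2)%:E).
  move=> mh; apply/measurable_EFinP; apply: measurable_funM => //.
  exact: measurable_enorm_sqr.
rewrite !Z ?(ltW s0)// -(@ge0_integralD _ _ _ mu _ mI)//; last 4 first.
- by move=> t _; rewrite lee_fin mulr_ge0// sqr_ge0.
- exact: mZ.
- by move=> t _; rewrite lee_fin mulr_ge0 ?sqr_ge0// ltW.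
- exact: mZ.
apply: ge0_le_integral => //.
- apply/measurable_EFinP; apply: measurableT_comp => //.
  by apply: measurable_funB; exact: measurable_enorm_sqr.
- by apply: emeasurable_funD; exact: mZ.
- by move=> t _; rewrite -EFinD lee_fin enorm_sqrB.
Qed.

Definition energy x : R -> R := (fun t => enorm (x t) ^+ 2) \_ (unitI R).

Lemma energy_ge0 x t : 0 <= energy x t.
Proof. by rewrite /energy patchE; case: ifP => // _; rewrite sqr_ge0. Qed.

Lemma measurable_energy x : measurable_fun setT (energy x).
Proof.
apply/(measurable_restrictT _ _).1; first exact: measurable_itv.
by apply: measurable_enorm_sqr; exact: L2fun_measurable.
Qed.

(** [enorm_sqrB] is integrated with s = e. Since y has norm 1, the result is (1 + 1/e) e^2 + e = e^2
    + 2 e, at most 3 e because e <= 1. *)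
Lemma closure_orbit_approx x (e : R) : closure (reparam_orbit q Gamma) x ->
  0 < e -> e <= 1 -> exists y a, [/\ density a,
    {ae mu, forall t, unitI R t -> y t = transport r a t}, L2dist x y < e &
    (\int[mu]_t (`|energy x t - a t|)%:E <= (3 * e)%:E)%E].
Proof.
move=> /closure_L2dist cx e0 e1; have [y [g [Gg _] yg] xy] := cx e e0.
have [a [da gE g'E]] := Gamma_tilde_density Gg.
have ya : {ae mu, forall t, unitI R t -> y t = transport r a t}.
  apply: (filterS2_ae yg (reparam_transport qr da gE g'E)) => t + + It.
  by move=> /(_ It) -> /(_ It).
exists y, a; split => //.
have mx := @L2fun_measurable _ _ x; have my := @L2fun_measurable _ _ y.
have [ma _ aI _] := da; have mI := @measurable_unitI R.
have Ly : L2sq y = 1%E.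
  by rewrite -(L2sq_transport fr da); apply: eq_ae_L2sq => //; exact: transport_measurable.
rewrite [leLHS](_ : _ = \int[mu]_(t in unitI R)
    (`|enorm (x t) ^+ 2 - enorm (y t) ^+ 2|)%:E)%E.
  apply: (le_trans (integral_enorm_sqrB_le mx my e0)); rewrite Ly mule1.
  apply: (@le_trans _ _ ((1 + e^-1)%:E * (e ^+ 2)%:E + e%:E)%E).
    rewrite leeD2r// lee_pmul2l ?lte_fin ?addr_gt0 ?invr_gt0//.
    exact: L2sq_L2dist_le.
  rewrite -EFinM -EFinD lee_fin mulrDl mul1r expr2 mulKf ?gt_eqF//.
  have : e * e <= e by rewrite ler_piMr// ltW.
  lra.
rewrite [LHS](_ : _ = \int[mu]_(t in unitI R) (`|enorm (x t) ^+ 2 - a t|)%:E)%E; last first.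
  rewrite [RHS]integral_mkcond; apply: eq_integral => t _; rewrite /energy !patchE.
  by case: ifPn => //; rewrite notin_setE => /aI ->; rewrite subrr normr0.
have m_enorm := measurable_enorm_sqr mx.
apply: ae_eq_integral => //.
- apply/measurable_EFinP; apply: measurableT_comp => //.
  by apply: measurable_funB => //; exact: measurable_funTS.
- apply/measurable_EFinP; apply: measurableT_comp => //.
  by apply: measurable_funB => //; exact: measurable_enorm_sqr.
- apply: (filterS2_ae ya (enorm_transport fr da)) => t + + It.
  by move=> /(_ It) -> /(_ It) ->.
Qed.

Lemma integral_le_dist (f g : R -> R) (k : R) : measurable_fun setT f ->
  measurable_fun setT g -> (forall t, 0 <= f t) -> (forall t, 0 <= g t) ->
  (\int[mu]_t (`|f t - g t|)%:E <= k%:E)%E ->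
  (\int[mu]_t (f t)%:E <= \int[mu]_t (g t)%:E + k%:E)%E.
Proof.
move=> mf mg f0 g0 fgk.
have mfg : measurable_fun setT (fun t => (`|f t - g t|)%:E).
  by apply/measurable_EFinP; apply: measurableT_comp => //; exact: measurable_funB.
have mge : measurable_fun setT (EFin \o g) by exact/measurable_EFinP.
apply: le_trans (leeD2l _ fgk).
rewrite -(@ge0_integralD _ _ _ mu _ measurableT)//.
- apply: ge0_le_integral => //.
  + by move=> t _; rewrite lee_fin.
  + exact/measurable_EFinP.
  + exact: emeasurable_funD.
  + by move=> t _; rewrite -EFinD lee_fin -lerBlDl ler_norm.
- by move=> t _; rewrite lee_fin.
Qed.

(** The mass of the energy differs from the mass 1 of an approximating density by at most their L1
    distance, which is arbitrarily small. *)
Lemma closure_orbit_density x : closure (reparam_orbit q Gamma) x ->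
  density (energy x).
Proof.
move=> cx; split.
- exact: measurable_energy.
- exact: energy_ge0.
- by move=> t It; rewrite /energy patchE memNset.
have mm := measurable_energy x; have m0 := energy_ge0 x.
have small (e : R) : 0 < e -> exists a, density a /\
    (\int[mu]_t (`|energy x t - a t|)%:E <= e%:E)%E.
  move=> e0; pose e' := Num.min 1 (e / 3).
  have e'0 : 0 < e' by rewrite lt_min ltr01 divr_gt0.
  have e'1 : e' <= 1 by rewrite ge_min lexx.
  have [y [a [da _ _ H]]] := closure_orbit_approx cx e'0 e'1.
  exists a; split => //; apply: (le_trans H).
  by rewrite lee_fin mulrC -ler_pdivlMr// ge_min lexx orbT.
apply/eqP; rewrite eq_le; apply/andP; split.
  apply/lee_addgt0Pr => e e0; have [a [[ma a0 _ a1] H]] := small e e0.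
  by rewrite -a1; exact: integral_le_dist.
apply/lee_addgt0Pr => e e0; have [a [[ma a0 _ a1] H]] := small e e0.
rewrite -[leLHS]a1; apply: integral_le_dist => //.
by under eq_integral do rewrite distrC.
Qed.

(** One density [a] serves twice: T a is close to x by choice, and close to T m by stability, as [a]
    is L1 close to m. *)
Lemma closure_orbit_tilde x :
  closure (reparam_orbit q Gamma) x -> reparam_orbit q Gamma_tilde x.
Proof.
move=> cx; have dm := closure_orbit_density cx.
set m := energy x in dm.
have mx := @L2fun_measurable _ _ x; have mT := transport_measurable fr dm.
have mxT := L2measurableB mx mT.
have : L2sq (fun t => x t - transport r m t) = 0%E.
  apply/eqP; rewrite eq_le L2sq_ge0 andbT; apply/lee_addgt0Pr => e e0; rewrite add0e.
  have e4 : 0 < e / 4 by rewrite divr_gt0.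
  have [d d0 dP] := transport_stable fr e4.
  (* The bound 3 k <= d meets the constant of [closure_orbit_approx], and k <= 1 gives k^2 <= k <= e
     / 4; with the factors 2 of [L2sq_triangle] the total is at most e. *)
  pose k := Num.min 1 (Num.min (e / 4) (d / 3)).
  have k0 : 0 < k by rewrite !lt_min ltr01 e4 divr_gt0.
  have k1 : k <= 1 by rewrite ge_min lexx.
  have ke : k <= e / 4 by rewrite !ge_min lexx orbT.
  have kd : 3 * k <= d by rewrite mulrC -ler_pdivlMr// !ge_min lexx !orbT.
  have [y [a [da ya xy am]]] := closure_orbit_approx cx k0 k1.
  have my := @L2fun_measurable _ _ y; have mTa := transport_measurable fr da.
  rewrite (_ : (fun t => x t - transport r m t) =
      (fun t => (x t - y t) + (y t - transport r m t))); last first.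
    by apply/funext => t; rewrite addrA subrK.
  have h1 := L2sq_L2dist_le xy.
  have h2 : (L2sq (fun t => (y t - transport r m t)%R) <= (e / 4)%:E)%E.
    rewrite (@eq_ae_L2sq _ _ _ (fun t => transport r a t - transport r m t)).
    - apply: dP => //; apply: le_trans (_ : (3 * k)%:E <= d%:E)%E; last by rewrite lee_fin.
      by under eq_integral do rewrite distrC.
    - exact: L2measurableB.
    - exact: L2measurableB.
    - by apply: (filterS_ae ya) => t /[apply] ->.
  apply: (le_trans (L2sq_triangle (L2measurableB mx my) (L2measurableB my mT))).
  apply: (@le_trans _ _ (2%:E * (k ^+ 2)%:E + 2%:E * (e / 4)%:E)%E).
    by apply: leeD; rewrite lee_pmul2l.
  rewrite -!EFinM -EFinD lee_fin.
  have : k ^+ 2 <= k by rewrite expr2 ler_piMr// ltW.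
  lra.
move=> /(L2sq_eq0 mxT) xm; exists (primitive m); first exact: density_Gamma_tilde.
apply: (filterS2_ae xm (reparam_primitive qr dm)) => t + + It.
by move=> /(_ It)/eqP; rewrite subr_eq0 => /eqP -> /(_ It).
Qed.

End closure_of_orbit.

Theorem theorem3 (R : realType) (N : nat) (q : R -> 'rV[R]_N)
    (q_L2 : is_L2 q)
    (q_unit : {ae lebesgue_measure, forall t, unitI R t -> enorm (q t) = 1}) :
  closure (reparam_orbit q Gamma) = reparam_orbit q Gamma_tilde.
Proof.
have [r fr qr] := borel_unit_field_exists q_L2 q_unit.
apply/seteqP; split => x; first exact: closure_orbit_tilde fr qr x.
exact: orbit_tilde_closure fr qr x.
Qed.
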